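(* Let $A$ be an Artin algebra with radical $J$. If $J^{2m+1}=0$ and $A/J^m$ has finite representation type for some integer $m\geq 1$, then $A$ satisfies the Auslander--Reiten conjecture: every finitely generated left $A$-module $M$ with $\operatorname{Ext}_A^i(M,M\oplus A)=0$ for all $i>0$ is projective. In particular, every Artin algebra with radical cube zero (that is, $J^3=0$) satisfies the conjecture.
   Context: An Artin algebra is an algebra $A$ over a commutative Artinian ring $R$ that is finitely generated as an $R$-module; its radical $J$ is the Jacobson radical. All modules are finitely generated left modules. An Artin algebra $C$ has finite representation type if there are only finitely many isomorphism classes of finitely generated indecomposable left $C$-modules. *)

(* Defs.v *)
From HB Require Import structures.
From mathcomp Require Import all_boot all_order all_algebra.
From mathcomp Require Import boolp.
Set Implicit Arguments.
Unset Strict Implicit.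
Unset Printing Implicit Defensive.
Import GRing.Theory.
Local Open Scope ring_scope.
Local Open Scope quotient_scope.


(* Subsets are boolean predicates; classically (boolp) these are all subsets. *)
Definition left_ideal (A : pzRingType) (L : {pred A}) : Prop :=
  submod_closed (L : {pred A^o}).

Definition maximal_left_ideal (A : pzRingType) (L : {pred A}) : Prop :=
  [/\ left_ideal L,
      ~ (L =i predT) &
      forall K : {pred A}, left_ideal K -> {subset L <= K} ->
        K =i L \/ K =i predT].

Record ideal2 (A : pzRingType) := Ideal2 {
  ideal2_val :> {pred A};
  ideal2_zmod : zmod_closed ideal2_val;
  ideal2_mul : forall a x : A, x \in ideal2_val ->
    a * x \in ideal2_val /\ x * a \in ideal2_val }.

HB.instance Definition _ (A : pzRingType) (I : ideal2 A) :=
  GRing.isZmodClosed.Build A (ideal2_val I) (ideal2_zmod I).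

Definition ideal2_eq0 (A : pzRingType) (I : ideal2 A) : Prop :=
  forall x, x \in ideal2_val I -> x = 0.

Section Ideals.
Variable A : pzRingType.

Lemma ideal2T_zmod : zmod_closed (predT : {pred A}).
Proof. by []. Qed.

Lemma ideal2T_mul (a x : A) : x \in (predT : {pred A}) ->
  a * x \in (predT : {pred A}) /\ x * a \in (predT : {pred A}).
Proof. by []. Qed.

Definition ideal2T : ideal2 A := Ideal2 ideal2T_zmod ideal2T_mul.

Definition ideal2M_pred (I K : ideal2 A) : {pred A} := fun x =>
  `[< exists (n : nat) (a b : 'I_n -> A),
        [/\ forall i, a i \in ideal2_val I,
            forall i, b i \in ideal2_val K &
            x = \sum_(i < n) a i * b i] >].

Lemma ideal2M_zmod I K : zmod_closed (ideal2M_pred I K).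
Proof.
split.
  by apply/asboolP; exists 0%N, (fun _ => 0), (fun _ => 0);
     split; rewrite ?big_ord0 // => i; exact: rpred0.
move=> x y /asboolP[n [a [b [aI bK ->]]]] /asboolP[p [c [d [cI dK ->]]]].
apply/asboolP; exists (n + p)%N.
exists (fun i => match split i with inl j => a j | inr j => - c j end).
exists (fun i => match split i with inl j => b j | inr j => d j end).
split=> [i|i|].
- by case: split => j //; rewrite rpredN.
- by case: split.
- rewrite big_split_ord /= -sumrN; congr (_ + _); apply: eq_bigr => i _.
    by rewrite (unsplitK (inl i : 'I_n + 'I_p)).
  by rewrite (unsplitK (inr i : 'I_n + 'I_p)) mulNr.
Qed.

Lemma ideal2M_mul I K (a x : A) : x \in ideal2M_pred I K ->
  a * x \in ideal2M_pred I K /\ x * a \in ideal2M_pred I K.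
Proof.
move=> /asboolP[n [c [d [cI dK ->]]]]; split; apply/asboolP; exists n.
  exists (fun i => a * c i), d; split=> // [i|].
    by case: (ideal2_mul a (cI i)).
  by rewrite mulr_sumr; apply: eq_bigr => i _; rewrite mulrA.
exists c, (fun i => d i * a); split=> // [i|].
  by case: (ideal2_mul a (dK i)).
by rewrite mulr_suml; apply: eq_bigr => i _; rewrite mulrA.
Qed.

Definition ideal2M (I K : ideal2 A) : ideal2 A :=
  Ideal2 (@ideal2M_zmod I K) (@ideal2M_mul I K).

Fixpoint ideal2X (I : ideal2 A) (n : nat) : ideal2 A :=
  if n is n'.+1 then ideal2M (ideal2X I n') I else ideal2T.

Definition jacobson_pred : {pred A} := fun x =>
  `[< forall L : {pred A}, maximal_left_ideal L -> x \in L >].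

Lemma left_ideal_zmod (L : {pred A}) : left_ideal L -> zmod_closed L.
Proof.
move=> [L0 Lin]; split=> // x y xL yL.
by have := Lin (-1) y x yL xL; rewrite /GRing.scale /= mulN1r addrC.
Qed.

Lemma left_idealM (L : {pred A}) (a x : A) :
  left_ideal L -> x \in L -> a * x \in L.
Proof.
move=> [L0 Lin] xL; have := Lin a x 0 xL L0.
by rewrite /GRing.scale /= addr0.
Qed.

Lemma left_ideal_colon (L : {pred A}) (a : A) :
  left_ideal L -> left_ideal [pred y | y * a \in L].
Proof.
move=> [L0 Lin]; split; first by rewrite inE /= mul0r.
move=> c u v; rewrite !inE => uL vL.
by have := Lin c _ _ uL vL; rewrite /GRing.scale /= mulrDl mulrA.
Qed.

Lemma maximal_left_ideal_colon (L : {pred A}) (a : A) :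
  maximal_left_ideal L -> a \notin L ->
  maximal_left_ideal [pred y | y * a \in L].
Proof.
move=> [lL LnT Lmax] aL; split; first exact: left_ideal_colon.
  by move=> /(_ 1); rewrite !inE mul1r (negPf aL).
move=> K lK sK; have [K0 Kin] := lK; have [L0 Lin] := lL.
pose H : {pred A} := fun z => `[< exists k l, [/\ k \in K, l \in L & z = k * a + l] >].
have lH : left_ideal H.
  split; first by apply/asboolP; exists 0, 0; rewrite mul0r addr0.
  move=> c u v /asboolP[k [l [kK lL' ->]]] /asboolP[k' [l' [kK' lL'' ->]]].
  apply/asboolP; exists (c * k + k'), (c * l + l'); split.
  - exact: Kin.
  - exact: Lin.
  - by rewrite /GRing.scale /= mulrDr mulrDl mulrA addrACA.
have sLH : {subset L <= H}.
  by move=> z zL; apply/asboolP; exists 0, z; rewrite mul0r add0r.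
have [HL|HT] := Lmax H lH sLH.
  left=> y; apply/idP/idP => [yK|]; last exact: sK.
  by rewrite inE -HL; apply/asboolP; exists y, 0; rewrite addr0.
right=> y; rewrite [RHS]inE.
have /asboolP[k [l [kK lL' e]]] : y * a \in H by rewrite HT.
have ykK : y - k \in K.
  by apply: sK; rewrite inE mulrBl e addrAC subrr add0r.
have := Kin 1 _ _ ykK kK.
by rewrite /GRing.scale /= mul1r subrK.
Qed.

Lemma jacobson_zmod : zmod_closed jacobson_pred.
Proof.
split; first by apply/asboolP => L [[]].
move=> x y /asboolP xJ /asboolP yJ; apply/asboolP => L mL.
have [lL _ _] := mL; have [_] := left_ideal_zmod lL.
by apply; [exact: xJ | exact: yJ].
Qed.

Lemma jacobson_mul (a x : A) : x \in jacobson_pred ->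
  a * x \in jacobson_pred /\ x * a \in jacobson_pred.
Proof.
move=> /asboolP xJ; split; apply/asboolP => L mL; have [lL _ _] := mL.
  exact/left_idealM/xJ.
have [aL|aL] := boolP (a \in L); first exact: left_idealM.
by have := xJ _ (maximal_left_ideal_colon mL aL); rewrite inE.
Qed.

Definition jacobson : ideal2 A := Ideal2 jacobson_zmod jacobson_mul.

End Ideals.

(* The additive quotient is the library's; the library only equips quotients of
   commutative rings with a multiplication. *)
Section QuotientRing.
Variables (A : pzRingType) (I : ideal2 A).

Definition quot_ring : Type := {ideal_quot (ideal2_val I)}.

HB.instance Definition _ := GRing.Zmodule.on quot_ring.
HB.instance Definition _ : EqQuotient A _ quot_ring :=
  EqQuotient.on quot_ring.
HB.instance Definition _ := isZmodQuotient.Build A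
  (Quotient.equiv (ideal2_val I)) 0 -%R +%R quot_ring
  (lock _) (@Quotient.pi_opp _ _) (@Quotient.pi_add _ _).

Definition quot_one : quot_ring := lift_cst quot_ring 1.
Definition quot_mul := lift_op2 quot_ring *%R.

Canonical pi_quot_one_morph := PiConst quot_one.

Lemma pi_quot_mul : {morph \pi_quot_ring : x y / x * y >-> quot_mul x y}.
Proof.
move=> x y; unlock quot_mul; apply/eqP.
rewrite -(Quotient.idealrBE (ideal2_val I)).
rewrite -[_ * _](subrK (x * repr (\pi_quot_ring y))) -mulrBr.
rewrite -addrA -mulrBl rpredD //.
  have h : y - repr (\pi_quot_ring y) \in ideal2_val I.
    by rewrite (Quotient.idealrBE (ideal2_val I)) reprK.
  by case: (ideal2_mul x h).
have h : x - repr (\pi_quot_ring x) \in ideal2_val I.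
  by rewrite (Quotient.idealrBE (ideal2_val I)) reprK.
by case: (ideal2_mul (repr (\pi_quot_ring y)) h).
Qed.
Canonical pi_quot_mul_morph := PiMorph2 pi_quot_mul.

Lemma quot_mulA : associative quot_mul.
Proof. by move=> x y z; rewrite -[x]reprK -[y]reprK -[z]reprK !piE mulrA. Qed.

Lemma quot_mul1l : left_id quot_one quot_mul.
Proof. by move=> x; rewrite -[x]reprK !piE mul1r. Qed.

Lemma quot_mul1r : right_id quot_one quot_mul.
Proof. by move=> x; rewrite -[x]reprK !piE mulr1. Qed.

Lemma quot_mulDl : left_distributive quot_mul +%R.
Proof.
by move=> x y z; rewrite -[x]reprK -[y]reprK -[z]reprK !piE mulrDl.
Qed.

Lemma quot_mulDr : right_distributive quot_mul +%R.
Proof.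
by move=> x y z; rewrite -[x]reprK -[y]reprK -[z]reprK !piE mulrDr.
Qed.

HB.instance Definition _ := GRing.Zmodule_isPzRing.Build quot_ring
  quot_mulA quot_mul1l quot_mul1r quot_mulDl quot_mulDr.

End QuotientRing.


Definition artinian (R : comPzRingType) : Prop :=
  forall I : nat -> {pred R},
    (forall n, left_ideal (I n)) ->
    (forall n, {subset I n.+1 <= I n}) ->
    exists N, forall n, (N <= n)%N -> I n =i I N.

(* The algebra structure is given by a ring morphism from R to the centre of A,
   rather than by algType, so that the zero algebra is not excluded. *)
Definition artin_algebra (A : pzRingType) : Prop :=
  exists (R : comPzRingType) (phi : {rmorphism R -> A}),
    [/\ artinian R,
        forall r a, phi r * a = a * phi r &
        exists (n : nat) (g : 'I_n -> A),
          forall a, exists c : 'I_n -> R, a = \sum_(i < n) phi (c i) * g i].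


Section Modules.
Variable A : pzRingType.
Implicit Types M N : lmodType A.

Definition fin_gen M : Prop :=
  exists (n : nat) (g : 'I_n -> M),
    forall x, exists c : 'I_n -> A, x = \sum_(i < n) c i *: g i.

Definition isomorphic M N : Prop := exists f : {linear M -> N}, bijective f.

Definition zero_module M : Prop := forall x : M, x = 0.

Definition indecomposable M : Prop :=
  ~ zero_module M /\
  forall M1 M2 : lmodType A, isomorphic M (M1 * M2)%type ->
    zero_module M1 \/ zero_module M2.

Definition projective M : Prop :=
  forall (X Y : lmodType A) (p : {linear X -> Y}) (f : {linear M -> Y}),
    (forall y, exists x, p x = y) ->
    exists g : {linear M -> X}, forall u, p (g u) = f u.

Record proj_resolution M := ProjResolution {
  res_mod :> nat -> lmodType A;
  res_d : forall n, {linear res_mod n.+1 -> res_mod n};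
  res_aug : {linear res_mod 0 -> M};
  res_projective : forall n, projective (res_mod n);
  res_aug_surj : forall x, exists y, res_aug y = x;
  res_exact0 : forall x, res_aug x = 0 <-> exists y, res_d 0 y = x;
  res_exactS : forall n x, res_d n x = 0 <-> exists y, res_d n.+1 y = x }.

Definition cocycle M (P : proj_resolution M) N i (f : {linear P i -> N}) : Prop :=
  forall x, f (res_d P i x) = 0.

Definition coboundary M (P : proj_resolution M) N i :
    {linear P i -> N} -> Prop :=
  match i with
  | 0 => fun f => forall x, f x = 0
  | j.+1 => fun f =>
      exists g : {linear P j -> N}, forall x, f x = g (res_d P j x)
  end.

(* Ext^i_A(M, N) = 0. As Ext does not depend on the projective resolution P of
   M, it is enough that the cohomology of Hom(P, N) vanishes for one P. *)
Definition Ext_eq0 (i : nat) M N : Prop :=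
  exists P : proj_resolution M,
    forall f : {linear P i -> N}, cocycle f -> coboundary f.

End Modules.

Definition finite_rep_type (C : pzRingType) : Prop :=
  exists (n : nat) (F : 'I_n -> lmodType C),
    forall M : lmodType C, fin_gen M -> indecomposable M ->
      exists i, isomorphic M (F i).

Definition auslander_reiten (A : pzRingType) : Prop :=
  forall M : lmodType A, fin_gen M ->
    (forall i : nat, (0 < i)%N -> Ext_eq0 i M (M * A^o)%type) ->
    projective M.

(* Main.v *)
Require Import Defs.
From HB Require Import structures.
From mathcomp Require Import all_boot all_order all_algebra.
From mathcomp Require Import boolp classical_sets functions zify.

(** Let [M] be finitely generated with [Ext^i(M, M + A) = 0] for all [i > 0],
    and suppose that [M] is not projective.  Let [X_n] be the [n]-th syzygy of
    [M] in a minimal resolution.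

    For [n >= 1] the module [X_n] lies in the radical of a projective module, so
    [J^(2m)] kills it ([minimal_cover]).  Hence [X'_n = J^m X_n] and
    [X''_n = X_n / J^m X_n] are modules over [A / J^m] ([ideal_submodule]), and
    both are direct sums of members [F_a] of one finite family with, say, [s]
    members.  Record the multiplicities of [X'_k] and the negatives of those of
    [X''_k] in a vector [g_k] of length [2s].  The proof exhibits [2s + 1] of
    the [g_k] that would be linearly independent ([no_family]).

    For a large [N] let [c_p] be the functional on vectors of length [2s] whose
    entries are the lengths of [Ext^p(F_a, X_N)] and of [Ext^(p+1)(F_a, X_N)].
    Write [<g, c>] for the value of [c] at [g].  Exactness of
    [Ext^p(X_k) -> Ext^p(X'_k) -> Ext^(p+1)(X''_k) -> Ext^(p+1)(X_k)], all with
    values in [X_N], says that [<g_k, c_p>] is the length of the image of the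
    first map minus the length of the image of the last one ([elen_horse]).

    Since [Ext(M, A) = 0], taking syzygies is fully faithful on stable maps, so
    [Ext^p(X_k, X_N) = Ext^(p+k-N)(M, M) = 0] for [p > N - k] ([ext_syzygy]), but
    [Ext^(N-k)(X_k, X_N)] contains the class of the identity of [X_N], which is
    not zero ([syzygy_not_ext]).  Therefore [<g_k, c_p> = 0] for [p > N - k], and
    there are two cases for the leading term ([leading_term]).
    - If no syzygy of the inclusion of [X'_k] in [X_k] is stably zero, then the
      class of the identity restricts to a nonzero class on [X'_k], and
      [<g_k, c_(N-k)>] is positive.
    - Otherwise all high syzygies of the inclusion are stably zero.  For [N]
      large, restriction to [X'_k] is then zero in degrees [N - k - 1] and
      [N - k], so [<g_k, c_(N-k)> = 0], whereas the class of the identity comes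
      from [X''_k], so [<g_k, c_(N-k-1)>] is negative.
    The leading positions of [g_1, g_3, g_5, ...] are thus pairwise distinct, and
    these vectors are linearly independent.

    Lengths are taken over the Artinian base ring [R]; that finitely generated
    modules have finite length rests on [artinian_fin_len].  When [J^3 = 0] one
    takes [m = 1]: the modules killed by [J] are direct sums of the finitely many
    modules [A / L], for [L] in a finite set of maximal left ideals with
    intersection [J] ([jacobson_decomp]). *)

Set Implicit Arguments.
Unset Strict Implicit.
Unset Printing Implicit Defensive.
Import GRing.Theory.
Local Open Scope classical_set_scope.
Local Open Scope ring_scope.

(** * Length of modules *)

Section OpSub.
Variables (R : Type) (L : zmodType) (act : R -> L -> L).

(** Submodules are taken with respect to a bare family of operators, so that the
    same notion serves for ideals, for modules over [A] or [R], and for the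
    groups [Hom(U, Y)] seen inside all functions from [U] to [Y]. *)
Definition opsub (S : set L) : Prop :=
  [/\ S 0, forall x y, S x -> S y -> S (x - y)
    & forall r x, S x -> S (act r x)].

Lemma opsubN S x : opsub S -> S x -> S (- x).
Proof. by move=> [S0 SB _] Sx; rewrite -[- x]add0r; apply: SB. Qed.

Lemma opsubD S x y : opsub S -> S x -> S y -> S (x + y).
Proof.
move=> oS Sx Sy; have [_ SB _] := oS.
by rewrite -[y]opprK; apply: SB => //; apply: opsubN.
Qed.

Lemma opsubI S T : opsub S -> opsub T -> opsub (S `&` T).
Proof.
move=> [S0 SB SA] [T0 TB TA]; split=> [//|x y [? ?] [? ?]|r x [? ?]].
  by split; [apply: SB | apply: TB].
by split; [apply: SA | apply: TA].
Qed.

Definition sumset (S T : set L) : set L :=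
  [set x | exists s t, [/\ S s, T t & x = s + t]].

Lemma opsub_sum S T : (forall r, {morph act r : x y / x + y}) ->
  opsub S -> opsub T -> opsub (sumset S T).
Proof.
move=> actD [S0 SB SA] [T0 TB TA]; split.
- by exists 0, 0; rewrite addr0.
- move=> _ _ [s [t [Ss Tt ->]]] [s' [t' [Ss' Tt' ->]]].
  exists (s - s'), (t - t'); split; [exact: SB|exact: TB|].
  by rewrite opprD addrACA.
- move=> r _ [s [t [Ss Tt ->]]].
  by exists (act r s), (act r t); split; [exact: SA|exact: TA|exact: actD].
Qed.

(** A strictly increasing chain of [n + 1] submodules that ends at [S]. *)
Fixpoint chain (n : nat) (S : set L) : Prop :=
  if n is n'.+1 then opsub S /\ exists2 T, chain n' T & T `<` S else opsub S.

Lemma chain_opsub n S : chain n S -> opsub S.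
Proof. by case: n => [|n] // []. Qed.

Lemma chain_sub n S T : chain n S -> S `<=` T -> opsub T -> chain n T.
Proof.
case: n => [//|n] [oS [U cU ltUS]] sST oT; split=> //; exists U => //.
by split=> [|sTU]; [apply: subset_trans (proj1 ltUS) sST | apply: (proj2 ltUS); apply: subset_trans sTU].
Qed.

Definition fin_len (S : set L) : Prop := exists N, forall n, chain n S -> (n <= N)%N.

(** The supremum of the lengths of chains, or 0 if they are unbounded.  It is
    additive without any appeal to composition series, because chains split
    along a homomorphism. *)
Definition len (S : set L) : nat :=
  match pselect (exists n, chain n S /\ forall m, chain m S -> (m <= n)%N) with
  | left h => projT1 (cid h)
  | right _ => 0%N
  end.

Lemma lenP S : opsub S -> fin_len S ->
  chain (len S) S /\ forall m, chain m S -> (m <= len S)%N.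
Proof.
move=> oS [N leN]; rewrite /len; case: pselect => [h|[]].
  by case: (projT2 (cid h)).
have exb : exists n, `[< chain n S >] by exists 0; apply/asboolP.
have bnd n : `[< chain n S >] -> (n <= N)%N by move/asboolP/leN.
case: (ex_maxnP exb bnd) => n /asboolP cn maxn; exists n; split=> // m cm.
exact/maxn/asboolP.
Qed.

Lemma len_eq S n : opsub S -> fin_len S -> chain n S ->
  (forall m, chain m S -> (m <= n)%N) -> len S = n.
Proof.
move=> oS fS cn len_le; have [cS leS] := lenP oS fS.
by apply/eqP; rewrite eqn_leq len_le // leS.
Qed.

Lemma fin_sub S T : opsub T -> S `<=` T -> fin_len T -> fin_len S.
Proof. by move=> oT sST [N leN]; exists N => n cn; apply/leN/(chain_sub cn). Qed.

Lemma len_le S T : opsub S -> opsub T -> S `<=` T -> fin_len T -> (len S <= len T)%N.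
Proof.
move=> oS oT sST fT; have [cS _] := lenP oS (fin_sub oT sST fT).
by have [_ ->//] := lenP oT fT; apply: chain_sub cS sST oT.
Qed.

Lemma len_eq_sub S T : opsub S -> opsub T -> S `<=` T -> fin_len T ->
  len S = len T -> S = T.
Proof.
move=> oS oT sST fT eST; have [cS _] := lenP oS (fin_sub oT sST fT).
apply/seteqP; split=> //; apply: contrapT => nsTS.
have [_ leT] := lenP oT fT.
have /leT : chain (len S).+1 T by split=> //; exists S.
by rewrite -eST ltnn.
Qed.

Lemma fin_len0 : fin_len [set 0].
Proof.
exists 0 => -[//|n] [oS [T cT [sT0 []]]] x /= ->.
by have [] := chain_opsub cT.
Qed.

Lemma len0 : (forall r, act r 0 = 0) -> len [set 0] = 0.
Proof.
move=> act0; have o0 : opsub [set 0].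
  by split=> [//|x y -> ->|r x ->] /=; rewrite ?subr0.
apply: (@len_eq _ 0) => // [|[//|n]]; first exact: fin_len0.
move=> [oS [T cT [sT0 []]]] x /= ->.
by have [] := chain_opsub cT.
Qed.

(** A member of least length is minimal as soon as its length is finite. *)
Lemma len_min (P : set (set L)) S0 : P S0 -> (forall S, P S -> opsub S) ->
  exists2 S, P S & forall T, P T -> T `<=` S -> fin_len S -> T = S.
Proof.
move=> PS0 Pop.
have exb : exists n, `[< exists2 S, P S & len S = n >].
  by exists (len S0); apply/asboolP; exists S0.
case: (ex_minnP exb) => n /asboolP[S PS <-] minS; exists S => // T PT sTS fS.
apply: len_eq_sub => //; try exact: Pop.
apply/eqP; rewrite eqn_leq minS ?andbT ?len_le //; try exact: Pop.
by apply/asboolP; exists T.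
Qed.

End OpSub.

Section OpMap.
Variables (R : Type) (L L' : zmodType).
Variables (act : R -> L -> L) (act' : R -> L' -> L').
Variable f : L -> L'.
Hypothesis fB : forall x y, f (x - y) = f x - f y.
Hypothesis fA : forall r x, f (act r x) = act' r (f x).

Let f0 : f 0 = 0.
Proof. by rewrite -(subrr 0) fB subrr. Qed.

Lemma opsub_preim T : opsub act' T -> opsub act (f @^-1` T).
Proof.
move=> [T0 TB TA]; split=> [|x y|r x] /=; first by rewrite f0.
  by rewrite fB; apply: TB.
by rewrite fA; apply: TA.
Qed.

Lemma opsub_im S : opsub act S -> opsub act' (f @` S).
Proof.
move=> [S0 SB SA]; split.
- by exists 0.
- by move=> _ _ [x Sx <-] [y Sy <-]; exists (x - y); rewrite ?fB //; apply: SB.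
- by move=> r _ [x Sx <-]; exists (act r x); rewrite ?fA //; apply: SA.
Qed.

Definition kerset : set L := [set x | f x = 0].

Hypothesis act'0 : forall r, act' r 0 = 0.

Lemma opsub_ker : opsub act kerset.
Proof.
split=> [|x y|r x] /=; rewrite /kerset /= ?f0 //; first by rewrite fB => -> ->; rewrite subrr.
by rewrite fA => ->.
Qed.

Let oI S : opsub act S -> opsub act (S `&` kerset).
Proof. by move=> oS; apply: opsubI => //; apply: opsub_ker. Qed.

(** Each strict step [T < S] of a chain remains strict either on kernels or on
    images: if [T] and [S] agree on both, they are equal. *)
Lemma chain_split n S : chain act n S -> exists a b,
  [/\ (n <= a + b)%N, chain act a (S `&` kerset) & chain act' b (f @` S)].
Proof.
elim: n S => [|n IH] S cS.
  by exists 0, 0; split=> //=; [apply: oI | apply: opsub_im].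
have [oS [T cT [sTS nST]]] := cS; have oT := chain_opsub cT.
have [a [b [leab ca cb]]] := IH T cT.
have oSK := oI oS; have oSf := opsub_im oS.
have sK : T `&` kerset `<=` S `&` kerset by move=> x [/sTS].
have sf : f @` T `<=` f @` S by apply: image_subset.
have [sKT|nK] := pselect (S `&` kerset `<=` T `&` kerset); last first.
  exists a.+1, b; split; first by rewrite addSn ltnS.
    by split=> //; exists (T `&` kerset).
  exact: chain_sub cb sf oSf.
have [sfT|nf] := pselect (f @` S `<=` f @` T); last first.
  exists a, b.+1; split; first by rewrite addnS ltnS.
    exact: chain_sub ca sK oSK.
  by split=> //; exists (f @` T).
exfalso; apply: nST => x Sx; have [|y Ty fyx] := sfT (f x); first by exists x.
rewrite -(subrK y x); apply: (opsubD oT) => //.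
have [] // : (T `&` kerset) (x - y).
apply: sKT; split; last by rewrite /kerset /= fB fyx subrr.
by have [_ SB _] := oS; apply: SB => //; apply: sTS.
Qed.

(** A chain of the image, pulled back, is placed on top of a chain of the
    kernel. *)
Lemma chain_join a b S Q : opsub act S -> chain act a (S `&` kerset) -> chain act' b Q ->
  Q `<=` f @` S -> chain act (a + b) (S `&` f @^-1` Q).
Proof.
move=> oS ca; elim: b Q => [|b IH] Q cQ sQ.
  rewrite addn0; apply: chain_sub ca _ _; last first.
    by apply: opsubI => //; apply: opsub_preim; apply: chain_opsub cQ.
  by move=> x [Sx fx]; split=> //; rewrite /= fx; have [] := chain_opsub cQ.
have [oQ [T cT [sTQ nQT]]] := cQ; rewrite addnS; split.
  by apply: opsubI => //; apply: opsub_preim.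
exists (S `&` f @^-1` T); first by apply: IH => //; apply: subset_trans sQ.
split=> [x [Sx Tx]|sQT]; first by split=> //; apply: sTQ.
apply: nQT => y Qy; have [x Sx xy] := sQ y Qy.
by rewrite -xy; have [] := sQT x; first by split=> //=; rewrite xy.
Qed.

Lemma fin_map S : fin_len act (S `&` kerset) -> fin_len act' (f @` S) -> fin_len act S.
Proof.
move=> [N leN] [N' leN']; exists (N + N')%N => n /chain_split[a [b [le_n ca cb]]].
by apply: leq_trans le_n _; apply: leq_add; [apply: leN | apply: leN'].
Qed.

Lemma fin_im S : opsub act S -> fin_len act S -> fin_len act' (f @` S).
Proof.
move=> oS [N leN]; exists N => n cn.
have := @chain_join 0 n S _ oS (oI oS) cn (fun _ h => h).
by move=> /chain_sub h; apply: leN; apply: h => // x [].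
Qed.

Lemma len_map S : opsub act S -> fin_len act S ->
  len act S = (len act (S `&` kerset) + len act' (f @` S))%N.
Proof.
move=> oS fS; have oK := oI oS; have oF := opsub_im oS.
have fK : fin_len act (S `&` kerset) by apply: fin_sub fS => // x [].
have fF := fin_im oS fS.
have [cK leK] := lenP oK fK; have [cF leF] := lenP oF fF.
apply: len_eq => //.
  have := chain_join oS cK cF (fun _ h => h).
  by move=> /chain_sub h; apply: h => // x [].
move=> n /chain_split[a [b [le_n ca cb]]]; apply: leq_trans le_n _.
by apply: leq_add; [apply: leK | apply: leF].
Qed.

Lemma len_inj S : (forall r, act r 0 = 0) -> opsub act S -> fin_len act S ->
  (forall x, S x -> f x = 0 -> x = 0) -> len act' (f @` S) = len act S.
Proof.
move=> act0 oS fS injf; rewrite (len_map oS fS).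
suff -> : S `&` kerset = [set 0] by rewrite len0.
apply/seteqP; split=> [x [Sx fx]|x -> /=]; first exact: injf.
by split; [case: oS|].
Qed.

End OpMap.

Section FinLen.
Variables (R : Type) (L L' : zmodType).
Variables (act : R -> L -> L) (act' : R -> L' -> L').
Hypothesis act'0 : forall r, act' r 0 = 0.

(** Meant for evaluations: they embed free modules and modules of homomorphisms
    in finite powers of the target. *)
Lemma fin_joint n (e : 'I_n -> L -> L') (T : set L') (S : set L) :
  (forall i x y, e i (x - y) = e i x - e i y) ->
  (forall i r x, e i (act r x) = act' r (e i x)) ->
  opsub act' T -> fin_len act' T -> opsub act S ->
  (forall i x, S x -> T (e i x)) ->
  (forall x, S x -> (forall i, e i x = 0) -> x = 0) -> fin_len act S.
Proof.
move=> eB eA oT fT; elim: n e eB eA S => [|n IH] e eB eA S oS eT einj.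
  have -> : S = [set 0]; last exact: fin_len0.
  apply/seteqP; split=> [x Sx|x ->]; last by case: oS.
  by apply: einj => // -[].
apply: (fin_map (eB ord0) (eA ord0)) => //.
  apply: (IH (fun i => e (lift ord0 i))) => //.
  - by apply: opsubI => //; apply: opsub_ker (eB ord0) (eA ord0) act'0.
  - by move=> i x [Sx _]; apply: eT.
  - move=> x [Sx x0] xi; apply: einj => // i.
    by have [j ->|->] := unliftP ord0 i; [apply: xi | apply: x0].
apply: fin_sub fT => // _ [x Sx <-]; exact: eT.
Qed.

End FinLen.

Lemma fin_sumset (R : Type) (L : zmodType) (act : R -> L -> L) (S T : set L) :
  (forall r x y, act r (x + y) = act r x + act r y) ->
  opsub act S -> opsub act T -> fin_len act S -> fin_len act T ->
  fin_len act (sumset S T).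
Proof.
move=> actD oS oT fS fT.
have act0 r : act r 0 = 0 by apply: (addrI (act r 0)); rewrite -actD !addr0.
pose act2 r (p : L * L) := (act r p.1, act r p.2).
pose ST : set (L * L) := [set p | S p.1 /\ T p.2].
have oST : opsub act2 ST.
  have [S0 SB SA] := oS; have [T0 TB TA] := oT.
  split=> [//|x y [? ?] [? ?]|r x [? ?]]; split=> /=; by [apply: SB|apply: TB|apply: SA|apply: TA].
have act20 r : act2 r 0 = 0 by rewrite /act2 /= !act0.
have fST : fin_len act2 ST.
  apply: (@fin_map _ _ _ act2 act fst) => //.
    apply: (@fin_joint _ _ _ act2 act _ 1 (fun _ => snd) T) => //.
    - by apply: opsubI => //; apply: (@opsub_ker _ _ _ act2 act fst).
    - by move=> _ p [[]].
    - by move=> [x y] [_ x0] /(_ ord0) /= y0; congr (_, _).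
  by apply: fin_sub fS => // _ [p [Sp _] <-].
have -> : sumset S T = (fun p => p.1 + p.2) @` ST.
  apply/seteqP; split=> [_ [s [t [Ss Tt ->]]]|_ [[s t] [/= Ss Tt] <-]].
    by exists (s, t).
  by exists s, t.
by apply: fin_im fST => //= x y; rewrite opprD addrACA.
Qed.

(** * Commutative Artinian rings have finite length *)

Section Artinian.
Variable R : comPzRingType.
Hypothesis artR : artinian R.

Let act (r x : R) : R := r * x.

Lemma artinian_min (P : set R -> Prop) S0 : P S0 -> (forall S, P S -> opsub act S) ->
  exists2 S, P S & forall T, P T -> T `<=` S -> T = S.
Proof.
move=> PS0 Pop; apply: contrapT => nomin.
have next (s : {S | P S}) : {t : {S | P S} | sval t `<` sval s}.
  apply: cid; apply: contrapT => nex; apply: nomin; exists (sval s); first exact: svalP.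
  move=> T PT sTS; apply/seteqP; split=> //; apply: contrapT => nST.
  by apply: nex; exists (exist _ T PT).
pose fix I n : {S | P S} := if n is n'.+1 then sval (next (I n')) else exist _ S0 PS0.
have ltI n : sval (I n.+1) `<` sval (I n) by exact: svalP (next (I n)).
pose J n : {pred R} := fun x => `[< sval (I n) x >].
have [n|n x|N eqN] := artR (I := J).
- have [S_0 SB SA] := Pop _ (svalP (I n)); split; first exact/asboolP.
  move=> a x y /asboolP Sx /asboolP Sy; apply/asboolP.
  by apply: (opsubD (Pop _ (svalP (I n)))) => //; apply: SA.
- by move=> /asboolP; have [sub _] := ltI n => /sub h; apply/asboolP.
have [_] := ltI N; apply=> x Ix.
have : x \in J N.+1 by rewrite (eqN N.+1 (leqnSn N)); apply/asboolP.
by move/asboolP.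
Qed.

(** Take an ideal [I] minimal among those of infinite length.  For each [r],
    multiplication by [r] is zero or onto on [I], hence the elements that do not
    kill [I] act invertibly, and [I] is a vector space.  A submodule
    maximal for avoiding a given nonzero vector is then a hyperplane: being
    proper it has finite length, and so has [I]. *)
Lemma artinian_fin_len : fin_len act setT.
Proof.
have oT : opsub act setT by [].
have actD r x y : act r (x + y) = act r x + act r y by exact: mulrDr.
apply: contrapT => nfT.
have [I [oI nfI] minI] := @artinian_min (fun S => opsub act S /\ ~ fin_len act S) setT
  (conj oT nfT) (fun S h => proj1 h).
have finlt S : opsub act S -> S `<=` I -> S <> I -> fin_len act S.
  by move=> oS sSI neSI; apply: contrapT => nfS; apply: neSI; apply: minI.
have actB r x y : act r (x - y) = act r x - act r y by exact: mulrBr.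
have actC r s x : act r (act s x) = act s (act r x) by rewrite /act mulrCA.
have act0 r : act r 0 = 0 by exact: mulr0.
have [I0 IB IA] := oI.
have dich r : (forall x, I x -> r * x = 0) \/ (forall x, I x -> exists2 y, I y & x = r * y).
  have [k0|nk0] := pselect (forall x, I x -> r * x = 0); [by left|right].
  have fK : fin_len act (I `&` kerset (act r)).
    apply: finlt => [| x []//|eK]; first by apply: opsubI => //; apply: (opsub_ker (actB r) (actC r)).
    by apply: nk0 => x; rewrite -eK => -[].
  have nfim : ~ fin_len act (act r @` I).
    by move=> fim; apply: nfI; apply: (fin_map (actB r) (actC r)).
  have eI : act r @` I = I.
    apply: minI; last by move=> _ [x Ix <-]; apply: IA.
    by split=> //; apply: (opsub_im (actB r) (actC r)).
  by move=> x; rewrite -{1}eI => -[y Iy <-]; exists y.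
have invr r : ~ (forall x, I x -> r * x = 0) -> exists c, forall x, I x -> c * (r * x) = x.
  move=> nr; have [//|surj] := dich r.
  (* The ideals generated by the powers of [r] stabilise: [r ^+ k = c * r ^+ k.+1]. *)
  have [||S [k eS] minS] := @artinian_min (fun S => exists k, S = [set x | exists c, x = c * r ^+ k])
     [set x | exists c, x = c * r ^+ 0]; first by exists 0%N.
    move=> _ [k ->]; split; first by exists 0; rewrite mul0r.
      by move=> _ _ [c ->] [d ->]; exists (c - d); rewrite mulrBl.
    by move=> a _ [c ->]; exists (a * c); rewrite /act mulrA.
  have e : [set x | exists c, x = c * r ^+ k.+1] = S.
    apply: minS; first by exists k.+1.
    by rewrite eS => _ [c ->]; exists (c * r); rewrite -mulrA -exprS.
  have [c ec] : [set x | exists c, x = c * r ^+ k.+1] (r ^+ k).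
    by rewrite e eS; exists 1; rewrite mul1r.
  exists c => x Ix.
  have [y Iy ->] : exists2 y, I y & x = r ^+ k * y.
    elim: (k) => [|j [y Iy ->]]; first by exists x; rewrite ?expr0 ?mul1r.
    by have [z Iz ->] := surj y Iy; exists z; rewrite // exprSr mulrA.
  by rewrite {2}ec exprS !mulrA.
have [x Ix nx0] : exists2 x, I x & x <> 0.
  apply: contrapT => nex; apply: nfI; have -> : I = [set 0]; last exact: fin_len0.
  by apply/seteqP; split=> [x Ix|x ->//]; apply: contrapT => ?; apply: nex; exists x.
have [K [[[oK sKI] nKx] maxK]] : exists K, ((opsub act K /\ K `<=` I) /\ ~ K x) /\
    forall B, K `<` B -> ~ ((opsub act B /\ B `<=` I) /\ ~ B x).
  (* [set0] is allowed because the union of an empty family is empty. *)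
  have [F FP Ftot|K [[PK nKx] maxK]] := @Zorn_bigcup R (fun K => (K = set0 \/ opsub act K /\ K `<=` I) /\ ~ K x).
    split; last by move=> [K FK Kx]; have [_ nK] := FP K FK; apply: nK.
    have [[K FK neK]|nex] := pselect (exists2 K, F K & K !=set0); last first.
      left; apply/seteqP; split=> // y [K FK Ky]; case: nex; exists K => //; by exists y.
    right; split; last first.
      by move=> y [T FT Ty]; have [[T0|[_ sTI]] _] := FP T FT; [rewrite T0 in Ty | apply: sTI].
    have oF T : F T -> T !=set0 -> opsub act T.
      by move=> FT [y Ty]; have [[T0|[]]//] := FP T FT; rewrite T0 in Ty.
    split.
    - by exists K => //; have [] := oF K FK neK.
    - move=> y z [T FT Ty] [U FU Uz].
      have [sTU|sUT] := Ftot T U FT FU.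
        by exists U => //; have [_ UB _] := oF U FU (ex_intro _ z Uz); apply: UB => //; apply: sTU.
      by exists T => //; have [_ TB _] := oF T FT (ex_intro _ y Ty); apply: TB => //; apply: sUT.
    - move=> r y [T FT Ty]; exists T => //.
      by have [_ _ TA] := oF T FT (ex_intro _ y Ty); apply: TA.
  have [K0|oKI] := PK; last first.
    by exists K; split=> // B ltKB [oB nBx]; apply: (maxK B ltKB); split=> //; right.
  exfalso; apply: (maxK [set 0]).
    by rewrite K0; split=> // /(_ 0); apply.
  split; last by move=> /= x0; apply: nx0.
  right; split; last by move=> y ->.
  by split=> [//|y z -> ->|r y ->] /=; rewrite ?subr0.
pose Rx : set R := [set y | exists c, y = c * x].
have oRx : opsub act Rx.
  split; first by exists 0; rewrite mul0r.
    by move=> _ _ [c ->] [d ->]; exists (c - d); rewrite mulrBl.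
  by move=> a _ [c ->]; exists (a * c); rewrite /act mulrA.
have oSum := opsub_sum actD oK.
have eI : I = sumset K Rx.
  apply/seteqP; split=> [y Iy|_ [s [_ [Ks [c ->] ->]]]]; last first.
    by apply: (opsubD oI); [apply: sKI | apply: IA].
  apply: contrapT => ny.
  pose Ry : set R := [set z | exists c, z = c * y].
  have oRy : opsub act Ry.
    split; first by exists 0; rewrite mul0r.
      by move=> _ _ [c ->] [d ->]; exists (c - d); rewrite mulrBl.
    by move=> a _ [c ->]; exists (a * c); rewrite /act mulrA.
  apply: (maxK (sumset K Ry)).
    split=> [z Kz|sub].
      by exists z, 0; rewrite addr0; split=> //; exists 0; rewrite mul0r.
    apply: ny; exists y, 0; rewrite addr0; split=> //; last by exists 0; rewrite mul0r.
    apply: sub; exists 0, y; rewrite add0r; split=> //; first by case: oK.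
    by exists 1; rewrite mul1r.
  split; first split; first exact: oSum.
    move=> _ [s [_ [Ks [c ->] ->]]].
    by apply: (opsubD oI); [apply: sKI | apply: IA].
  move=> [s [_ [Ks [c ->] ex]]].
  have [d dc] : exists d, forall x, I x -> d * (c * x) = x.
    by apply: invr => c0; apply: nKx; rewrite ex c0 // addr0.
  apply: ny; exists (- (d * s)), (d * x); split.
  - by apply: (opsubN oK); have [_ _ KA] := oK; apply: KA.
  - by exists d.
  - by rewrite ex mulrDr dc // addKr.
apply: nfI; rewrite eI; apply: (fin_sumset actD) => //.
  by apply: finlt => // eKI; apply: nKx; rewrite eKI.
(* [Rx] is simple, its nonzero elements being invertible multiples of [x]. *)
exists 1%N => -[//|[//|n]] [_ [T [oTT [U cU ltUT]] ltTx]].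
have oU := chain_opsub cU.
have allx V : opsub act V -> V `<=` Rx -> forall y, V y -> y <> 0 -> Rx `<=` V.
  move=> [_ _ VA] sV y Vy ny0 _ [e ->].
  have [c ey] := sV y Vy.
  have [d dc] : exists d, forall x, I x -> d * (c * x) = x.
    by apply: invr => c0; apply: ny0; rewrite ey c0.
  by rewrite -(dc x Ix) -ey; apply: (VA); apply: VA.
have [y Ty ny] : exists2 y, T y & y <> 0.
  apply: contrapT => nex; have [sUT []] := ltUT => y Ty.
  have [->|?] := pselect (y = 0); first by case: oU.
  by case: nex; exists y.
by have [sT []] := ltTx; apply: allx Ty ny.
Qed.

End Artinian.

(** * Submodules, quotients and exact sequences *)

Section Lin.
Variables (A : pzRingType) (U V : lmodType A) (f : U -> V).
Hypothesis fL : linear f.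

Definition mklin : {linear U -> V} :=
  HB.pack f (GRing.isLinear.Build A U V *:%R f fL).

End Lin.

Section Modules.
Variable A : pzRingType.
Implicit Types U V W X Y P Q : lmodType A.

Record ses U V W (i : {linear U -> V}) (p : {linear V -> W}) : Prop := Ses {
  ses_inj : forall u, i u = 0 -> u = 0;
  ses_surj : forall w, exists v, p v = w;
  ses_comp : forall u, p (i u) = 0;
  ses_exact : forall v, p v = 0 -> exists u, i u = v }.

(** When [i] is the inclusion of a syzygy of [M] in a projective module, the maps
    that extend are those whose class in [Ext(M, Y)] vanishes. *)
Definition ext_to U V Y (i : {linear U -> V}) (f : {linear U -> Y}) : Prop :=
  exists g : {linear V -> Y}, forall u, g (i u) = f u.

Lemma ses_injective U V W (i : {linear U -> V}) (p : {linear V -> W}) :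
  ses i p -> injective i.
Proof.
move=> s u v e; apply/eqP; rewrite -subr_eq0; apply/eqP; apply: (ses_inj s).
by rewrite linearB e subrr.
Qed.

Section Sub.
Variables (V : lmodType A) (S : set V).
Hypothesis oS : opsub *:%R S.

Let P : {pred V} := fun x => `[< S x >].

Fact sub_closed : submod_closed P.
Proof.
have [S0 SB SA] := oS; split; first exact/asboolP.
move=> a x y /asboolP Sx /asboolP Sy; apply/asboolP.
by apply: (opsubD oS) => //; apply: SA.
Qed.

HB.instance Definition _ := GRing.isSubmodClosed.Build A V P sub_closed.

Inductive sub_mod : predArgType := SubMod x & x \in P.
Definition sub_mod_val u := let: SubMod x _ := u in x.
HB.instance Definition _ := [isSub for sub_mod_val].
HB.instance Definition _ := [Choice of sub_mod by <:].
HB.instance Definition _ := [SubChoice_isSubLmodule of sub_mod by <:].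

Lemma sub_exists : exists (K : lmodType A) (i : {linear K -> V}),
  injective i /\ forall x, S x <-> exists k, i k = x.
Proof.
exists (sub_mod : lmodType A), (val : {linear _ -> _}); split; first exact: val_inj.
move=> x; split=> [Sx|[[y Py] <-]]; last exact/asboolP.
have Px : x \in P by exact/asboolP.
by exists (SubMod Px).
Qed.

End Sub.

Section Quo.
Variables (V : lmodType A) (S : set V).
Hypothesis oS : opsub *:%R S.

Let P : {pred V} := fun x => `[< S x >].

Fact quo_closed : zmod_closed P.
Proof.
have [S0 SB SA] := oS; split; first exact/asboolP.
by move=> x y /asboolP Sx /asboolP Sy; apply/asboolP; apply: SB.
Qed.

HB.instance Definition _ := GRing.isZmodClosed.Build V P quo_closed.

Definition quo_mod : Type := {ideal_quot P}.
HB.instance Definition _ := GRing.Zmodule.on quo_mod.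

Let pi (x : V) : quo_mod := \pi_({ideal_quot P})%qT x.

Let pi_eq x y : pi x = pi y <-> S (x - y).
Proof.
split=> [e|Sxy].
  suff : x - y \in P by move/asboolP.
  by rewrite (Quotient.idealrBE P); apply/eqP.
by apply/eqP; rewrite /pi -(Quotient.idealrBE P); apply/asboolP.
Qed.

Let piD x y : pi (x + y) = pi x + pi y.
Proof. exact: Quotient.pi_add. Qed.

Let reprK (q : quo_mod) : pi (repr (q : {ideal_quot P})) = q.
Proof. exact: generic_quotient.reprK. Qed.

Definition quo_scale (a : A) (q : quo_mod) : quo_mod :=
  pi (a *: repr (q : {ideal_quot P})).

Let quo_scaleE a x : quo_scale a (pi x) = pi (a *: x).
Proof.
apply/pi_eq; rewrite -scalerBr; have [_ _ SA] := oS; apply: SA; apply/pi_eq.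
exact: reprK.
Qed.

Fact quo_scaleA a b v : quo_scale a (quo_scale b v) = quo_scale (a * b) v.
Proof. by rewrite -[v]reprK !quo_scaleE scalerA. Qed.

Fact quo_scale1 : left_id 1 quo_scale.
Proof. by move=> v; rewrite -[v]reprK !quo_scaleE scale1r. Qed.

Fact quo_scaleDr : right_distributive quo_scale +%R.
Proof.
by move=> a u v; rewrite -[u]reprK -[v]reprK -piD !quo_scaleE scalerDr piD.
Qed.

Fact quo_scaleDl v : {morph quo_scale^~ v : a b / a + b}.
Proof. by move=> a b; rewrite -[v]reprK !quo_scaleE scalerDl piD. Qed.

HB.instance Definition _ := GRing.Zmodule_isLmodule.Build A quo_mod
  quo_scaleA quo_scale1 quo_scaleDr quo_scaleDl.

Lemma quo_exists : exists (W : lmodType A) (p : {linear V -> W}),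
  (forall w, exists v, p v = w) /\ forall x, S x <-> p x = 0.
Proof.
have piL : linear (pi : V -> quo_mod).
  by move=> a x y; rewrite piD -quo_scaleE.
exists (quo_mod : lmodType A), (mklin piL); split.
  by move=> w; exists (repr (w : {ideal_quot P})); apply: reprK.
have pi0 : pi 0 = 0 by apply: (addrI (pi 0)); rewrite -piD !addr0.
move=> x /=; rewrite -pi0; split=> [Sx|/pi_eq]; first by apply/pi_eq; rewrite subr0.
by rewrite subr0.
Qed.

End Quo.

Lemma ses_sub V (S : set V) : opsub *:%R S ->
  exists (K W : lmodType A) (i : {linear K -> V}) (p : {linear V -> W}),
    ses i p /\ forall x, S x <-> exists k, i k = x.
Proof.
move=> oS; have [K [i [injI Si]]] := sub_exists oS.
have [W [p [surjp Sp]]] := quo_exists oS.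
exists K, W, i, p; split=> //; split=> //.
- by move=> u iu0; apply: injI; rewrite iu0 linear0.
- by move=> u; apply/Sp/Si; exists u.
- by move=> v /Sp/Si.
Qed.

Lemma opsub_kernel V W (p : {linear V -> W}) : opsub *:%R [set v | p v = 0].
Proof.
split=> [|x y|a x] /=; first exact: linear0.
  by move=> px py; rewrite linearB px py subrr.
by move=> px; rewrite linearZZ px scaler0.
Qed.

Lemma kernel_exists V W (p : {linear V -> W}) : (forall w, exists v, p v = w) ->
  exists (K : lmodType A) (i : {linear K -> V}), ses i p.
Proof.
move=> surjp; have [K [i [injI Si]]] := sub_exists (opsub_kernel p).
exists K, i; split=> //; first by move=> u iu0; apply: injI; rewrite iu0 linear0.
  by move=> u; have [_ h] := Si (i u); exact: (h (ex_intro _ u erefl)).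
by move=> v pv; have [h _] := Si v; exact: (h pv).
Qed.

Lemma fac_inj U V Y (i : {linear U -> V}) (g : {linear Y -> V}) :
  injective i -> (forall y, exists u, i u = g y) ->
  exists h : {linear Y -> U}, forall y, i (h y) = g y.
Proof.
move=> injI ex; pose h y := projT1 (cid (ex y)).
have hE y : i (h y) = g y by exact: projT2 (cid (ex y)).
have hL : linear h by move=> a x y; apply: injI; rewrite linearP !hE linearP.
by exists (mklin hL).
Qed.

Lemma fac_surj V W Y (p : {linear V -> W}) (g : {linear V -> Y}) :
  (forall w, exists v, p v = w) -> (forall v, p v = 0 -> g v = 0) ->
  exists h : {linear W -> Y}, forall v, h (p v) = g v.
Proof.
move=> surjp g0; pose s w := projT1 (cid (surjp w)).
have sE w : p (s w) = w by exact: projT2 (cid (surjp w)).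
have geq u v : p u = p v -> g u = g v.
  move=> e; apply/eqP; rewrite -subr_eq0 -linearB; apply/eqP; apply: g0.
  by rewrite linearB e subrr.
have hL : linear (g \o s).
  by move=> a x y /=; rewrite -linearP; apply: geq; rewrite linearP !sE.
by exists (mklin hL) => v /=; apply: geq; rewrite sE.
Qed.

Definition lpair_fun U V W (f : {linear U -> V}) (g : {linear U -> W}) u := (f u, g u).

Lemma lpair_funL U V W (f : {linear U -> V}) (g : {linear U -> W}) : linear (lpair_fun f g).
Proof. by move=> a x y; rewrite /lpair_fun !linearP. Qed.

Definition lpair U V W (f : {linear U -> V}) (g : {linear U -> W}) :
  {linear U -> (V * W)%type} := mklin (lpair_funL f g).

Definition lcopair_fun U V W (f : {linear U -> W}) (g : {linear V -> W}) (x : U * V) :=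
  f x.1 + g x.2.

Lemma lcopair_funL U V W (f : {linear U -> W}) (g : {linear V -> W}) :
  linear (lcopair_fun f g).
Proof.
by move=> a x y; rewrite /lcopair_fun !linearP scalerDr addrACA.
Qed.

Definition lcopair U V W (f : {linear U -> W}) (g : {linear V -> W}) :
  {linear (U * V)%type -> W} := mklin (lcopair_funL f g).

Definition linl U V : {linear U -> (U * V)%type} := lpair idfun \0.
Definition linr U V : {linear V -> (U * V)%type} := lpair \0 idfun.
Definition lprod U V U' V' (f : {linear U -> U'}) (g : {linear V -> V'}) :
  {linear (U * V)%type -> (U' * V')%type} := lpair (f \o fst) (g \o snd).

Lemma ses_prod U V W U' V' W' (i : {linear U -> V}) (p : {linear V -> W})
    (i' : {linear U' -> V'}) (p' : {linear V' -> W'}) :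
  ses i p -> ses i' p' -> ses (lprod i i') (lprod p p').
Proof.
move=> s s'; split.
- by case=> u u' [/(ses_inj s) -> /(ses_inj s') ->].
- case=> w w'; have [v <-] := ses_surj s w; have [v' <-] := ses_surj s' w'.
  by exists (v, v').
- by case=> u u'; rewrite /= /lpair_fun /= (ses_comp s) (ses_comp s').
- case=> v v' [/(ses_exact s)[u <-] /(ses_exact s')[u' <-]].
  by exists (u, u').
Qed.

Lemma projective_prod U V : projective U -> projective V -> projective (U * V)%type.
Proof.
move=> pU pV X Y p f surjp.
have [g gE] := pU X Y p (f \o linl U V) surjp.
have [h hE] := pV X Y p (f \o linr U V) surjp.
exists (lcopair g h) => -[u v] /=; rewrite /lcopair_fun /= linearD gE hE /= -linearD.
by congr (f _); congr (_, _) => /=; rewrite ?addr0 ?add0r.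
Qed.

Lemma projective_retract P Q (r : {linear P -> Q}) (s : {linear Q -> P}) :
  (forall q, r (s q) = q) -> projective P -> projective Q.
Proof.
move=> rs pP X Y p f surjp; have [g gE] := pP X Y p (f \o r) surjp.
by exists (g \o s) => q /=; rewrite gE /= rs.
Qed.

Definition rowlin n V (v : 'I_n -> V) (c : 'rV[A]_n) := \sum_i c 0 i *: v i.

Lemma rowlinL n V (v : 'I_n -> V) : linear (rowlin v).
Proof.
move=> a c d; rewrite /rowlin scaler_sumr -big_split; apply: eq_bigr => i _.
by rewrite !mxE scalerDl scalerA.
Qed.

Definition free_map n V (v : 'I_n -> V) : {linear 'rV[A]_n -> V} := mklin (rowlinL v).

Definition row_unit n (i : 'I_n) : 'rV[A]_n := \row_j (if i == j then 1 else 0).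

Lemma row_expand n (c : 'rV[A]_n) : c = \sum_i c 0 i *: row_unit i.
Proof.
apply/rowP => j; rewrite summxE (bigD1 j) //= !mxE eqxx mulr1 big1 ?addr0 // => i nij.
by rewrite !mxE (negPf nij) mulr0.
Qed.

Lemma projective_free n : projective 'rV[A]_n.
Proof.
move=> X Y p f surjp; pose v i := projT1 (cid (surjp (f (row_unit i)))).
have vE i : p (v i) = f (row_unit i) by exact: projT2 (cid (surjp (f (row_unit i)))).
exists (free_map v) => c /=; rewrite /rowlin {2}[c]row_expand !linear_sum.
by apply: eq_bigr => i _; rewrite !linearZZ /= vE.
Qed.

Lemma fin_gen_free n : fin_gen ('rV[A]_n : lmodType A).
Proof. by exists n, (@row_unit n) => x; exists (x 0); apply: row_expand. Qed.

Lemma fin_gen_surj V W (p : {linear V -> W}) : (forall w, exists v, p v = w) ->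
  fin_gen V -> fin_gen W.
Proof.
move=> surjp [n [g gE]]; exists n, (p \o g) => w; have [v <-] := surjp w.
have [c ->] := gE v; exists c; rewrite linear_sum.
by apply: eq_bigr => i _; rewrite linearZZ.
Qed.

Lemma fin_gen_cover V : fin_gen V ->
  exists n (p : {linear 'rV[A]_n -> V}), forall v, exists x, p x = v.
Proof.
move=> [n [g gE]]; exists n, (free_map g) => v; have [c ->] := gE v.
by exists (\row_i c i); apply: eq_bigr => i _; rewrite mxE.
Qed.

Lemma fin_gen_prod U V : fin_gen U -> fin_gen V -> fin_gen (U * V)%type.
Proof.
move=> [n [g gE]] [m [h hE]].
exists (n + m)%N, (fun k => match fintype.split k with inl i => (g i, 0) | inr j => (0, h j) end).
move=> [u v]; have [c ->] := gE u; have [d ->] := hE v.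
exists (fun k => match fintype.split k with inl i => c i | inr j => d j end).
have sl i : fintype.split (lshift m i : 'I_(n + m)) = inl i by exact: (unsplitK (inl i)).
have sr i : fintype.split (rshift n i : 'I_(n + m)) = inr i by exact: (unsplitK (inr i)).
rewrite big_split_ord /=.
rewrite (eq_bigr (fun i => c i *: (g i, 0 : V))) => [|i _]; last by rewrite sl.
rewrite [X in _ + X](eq_bigr (fun i => d i *: (0 : U, h i))) => [|i _]; last by rewrite sr.
have e1 : \sum_(i < n) c i *: (g i, 0 : V) = (\sum_(i < n) c i *: g i, 0).
  elim/big_rec2: _ => // i x y _ ->; congr (_, _) => /=.
  by rewrite scaler0 addr0.
have e2 : \sum_(i < m) d i *: (0 : U, h i) = (0, \sum_(i < m) d i *: h i).
  elim/big_rec2: _ => // i x y _ ->; congr (_, _) => /=.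
  by rewrite scaler0 addr0.
by rewrite e1 e2; congr (_, _); rewrite /= ?addr0 ?add0r.
Qed.

End Modules.

(** * Resolutions and comparison of syzygies *)

Section Resolutions.
Variable A : pzRingType.
Implicit Types U V W M N P : lmodType A.

(** A projective resolution cut into short exact sequences: [sy r n] is the
    [n]-th syzygy of the resolved module [sy r 0]. *)
Record res := Res {
  sy : nat -> lmodType A;
  pr : nat -> lmodType A;
  inc : forall n, {linear sy n.+1 -> pr n};
  cov : forall n, {linear pr n -> sy n};
  res_ses : forall n, ses (inc n) (cov n);
  res_proj : forall n, projective (pr n) }.

Arguments res_proj : clear implicits.

Definition fgres (r : res) := forall n, fin_gen (pr r n).

Definition shift_res (r : res) (k : nat) : res :=
  @Res (fun n => sy r (n + k)) (fun n => pr r (n + k)) (fun n => inc r (n + k))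
    (fun n => cov r (n + k)) (fun n => res_ses r (n + k)) (fun n => res_proj r (n + k)).

Lemma fgres_sy r n : fgres r -> fin_gen (sy r n).
Proof. by move=> fr; apply: fin_gen_surj (ses_surj (res_ses r n)) (fr n). Qed.

Section Lifts.
Variables r1 r2 : res.

(** [f'] is the map induced on syzygies by a lift [a] of [f] to the
    projectives. *)
Definition square n (f : {linear sy r1 n -> sy r2 n})
    (f' : {linear sy r1 n.+1 -> sy r2 n.+1}) (a : {linear pr r1 n -> pr r2 n}) :=
  (forall x, cov r2 n (a x) = f (cov r1 n x)) /\
  (forall u, inc r2 n (f' u) = a (inc r1 n u)).

Definition lifts (al : forall n, {linear sy r1 n -> sy r2 n}) :=
  forall n, exists a, square (al n) (al n.+1) a.

Lemma lift_step n (f : {linear sy r1 n -> sy r2 n}) :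
  exists f' a, square f f' a.
Proof.
have [a aE] := res_proj r1 n _ _ _ (f \o cov r1 n) (ses_surj (res_ses r2 n)).
have [|f' f'E] := @fac_inj A _ _ _ (inc r2 n) (a \o inc r1 n) (ses_injective (res_ses r2 n)).
  move=> y; apply: (ses_exact (res_ses r2 n)).
  by rewrite /= aE /= (ses_comp (res_ses r1 n)) linear0.
by exists f', a.
Qed.

Lemma lifts_exist (f0 : {linear sy r1 0 -> sy r2 0}) :
  exists2 al, lifts al & al 0 = f0.
Proof.
pose next n f := cid (@lift_step n f).
pose fix al n : {linear sy r1 n -> sy r2 n} :=
  if n is n'.+1 then projT1 (next n' (al n')) else f0.
by exists al => // n; have [a aP] := projT2 (next n (al n)); exists a.
Qed.

(** A second lift [b] of the same map that kills the syzygy differs from [a] by a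
    map with values in the next syzygy, and this difference extends the map that
    [a] induces. *)
Lemma square_ext n f f' a (b : {linear pr r1 n -> pr r2 n}) :
  @square n f f' a -> (forall x, cov r2 n (b x) = f (cov r1 n x)) ->
  (forall u, b (inc r1 n u) = 0) -> ext_to (inc r1 n) f'.
Proof.
move=> [aE f'E] bE b0.
have [|g gE] := @fac_inj A _ _ _ (inc r2 n) (a \- b) (ses_injective (res_ses r2 n)).
  by move=> y; apply: (ses_exact (res_ses r2 n)); rewrite /= linearB aE bE subrr.
exists g => u; apply: (ses_injective (res_ses r2 n)).
by rewrite gE f'E /= b0 subr0.
Qed.

(** Once a map of syzygies is stably zero, so are all its further syzygies. *)
Lemma lifts_ext al n : lifts al ->
  ext_to (inc r1 n) (al n.+1) -> ext_to (inc r1 n.+1) (al n.+2).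
Proof.
move=> lal [g gE]; have [a aS] := lal n.+1.
have [b bE] := res_proj r1 n _ _ _ g (ses_surj (res_ses r2 n.+1)).
apply: (square_ext (b := b \o (inc r1 n \o cov r1 n.+1)) aS) => /= [x|u].
  by rewrite bE gE.
by rewrite (ses_comp (res_ses r1 n.+1)) !linear0.
Qed.

Lemma lifts_ext_leq al m n : lifts al -> (m <= n)%N ->
  ext_to (inc r1 m) (al m.+1) -> ext_to (inc r1 n) (al n.+1).
Proof.
move=> lal; elim: n => [|n IH]; first by rewrite leqn0 => /eqP->.
rewrite leq_eqVlt => /predU1P[-> //|lemn] em; apply: lifts_ext => //; exact: IH.
Qed.

(** Lifts of the zero map are null-homotopic. *)
Lemma lifts0 al n : lifts al -> (forall x, al 0 x = 0) -> ext_to (inc r1 n) (al n.+1).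
Proof.
move=> lal al0; apply: (lifts_ext_leq (m := 0)) => //; have [a aS] := lal 0.
by apply: (square_ext (b := \0) aS) => //= x; rewrite linear0 al0.
Qed.

End Lifts.

Lemma lifts_comp r1 r2 r3 (al : forall n, {linear sy r1 n -> sy r2 n})
    (be : forall n, {linear sy r2 n -> sy r3 n}) :
  lifts al -> lifts be -> lifts (fun n => be n \o al n).
Proof.
move=> lal lbe n; have [a [a1 a2]] := lal n; have [b [b1 b2]] := lbe n.
by exists (b \o a); split=> [x|u] /=; rewrite ?b1 ?a1 ?b2 ?a2.
Qed.

Lemma lifts_subid r (al : forall n, {linear sy r n -> sy r n}) :
  lifts al -> lifts (fun n => al n \- idfun).
Proof.
move=> lal n; have [a [a1 a2]] := lal n.
by exists (a \- idfun); split=> [x|u] /=; rewrite !linearB ?a1 ?a2.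
Qed.

(** A self-lift of the identity is homotopic to the identity. *)
Lemma lifts_id r (al : forall n, {linear sy r n -> sy r n}) n :
  lifts al -> (forall x, al 0 x = x) ->
  exists c : {linear pr r n -> sy r n.+1}, forall u, c (inc r n u) = al n.+1 u - u.
Proof.
move=> lal al0; have [|c cE] := lifts0 n (lifts_subid lal); last by exists c.
by move=> x /=; rewrite al0 subrr.
Qed.

Section Compare.
Variables (r1 r2 : res) (f : {linear sy r1 0 -> sy r2 0}) (g : {linear sy r2 0 -> sy r1 0}).
Hypotheses (gK : forall x, g (f x) = x) (fK : forall y, f (g y) = y).

Lemma compare : exists al be, [/\ @lifts r1 r2 al, @lifts r2 r1 be,
  forall n, exists c : {linear pr r1 n -> sy r1 n.+1},
    forall u, c (inc r1 n u) = be n.+1 (al n.+1 u) - u &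
  forall n, exists c : {linear pr r2 n -> sy r2 n.+1},
    forall u, c (inc r2 n u) = al n.+1 (be n.+1 u) - u].
Proof.
have [al lal al0] := lifts_exist f; have [be lbe be0] := lifts_exist g.
exists al, be; split=> // n.
  by apply: (lifts_id n (lifts_comp lal lbe)) => x /=; rewrite al0 be0 gK.
by apply: (lifts_id n (lifts_comp lbe lal)) => x /=; rewrite al0 be0 fK.
Qed.

(** Vanishing of [Ext^(n+1)] does not depend on the resolution. *)
Lemma ext_transfer N n : (forall h : {linear sy r1 n.+1 -> N}, ext_to (inc r1 n) h) ->
  forall h : {linear sy r2 n.+1 -> N}, ext_to (inc r2 n) h.
Proof.
move=> ext1 h; have [al [be [_ lbe _ ab]]] := compare.
have [k kE] := ext1 (h \o al n.+1); have [b [_ b2]] := lbe n; have [c cE] := ab n.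
exists ((k \o b) \- (h \o c)) => u /=.
by rewrite -b2 kE cE /= linearB subKr.
Qed.

End Compare.

Lemma Ext_eq0_res n M N : Ext_eq0 n.+1 M N -> exists r : res, sy r 0 = M /\
  forall h : {linear sy r n.+1 -> N}, ext_to (inc r n) h.
Proof.
move=> [P extP].
have kex k : exists (K : lmodType A) (i : {linear K -> P k}), injective i /\
    forall x, match k return P k -> Prop with
      | 0 => fun x => res_aug P x = 0 | k'.+1 => fun x => res_d P k' x = 0 end x
      <-> exists u, i u = x.
  by case: k => [|k]; apply: sub_exists; apply: opsub_kernel.
(* [K k] is the kernel of the map out of [P k], the syzygy of degree [k + 1]. *)
pose K k := projT1 (cid (kex k)).
have iex k : exists i : {linear K k -> P k}, injective i /\
    forall x, match k return P k -> Prop with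
      | 0 => fun x => res_aug P x = 0 | k'.+1 => fun x => res_d P k' x = 0 end x
      <-> exists u, i u = x by exact: projT2 (cid (kex k)).
pose i k := projT1 (cid (iex k)).
have injI k : injective (i k) by have [] := projT2 (cid (iex k)).
have iE k := proj2 (projT2 (cid (iex k))); rewrite -/(i _) in iE.
have cex k : exists c : {linear P k.+1 -> K k}, forall x, i k (c x) = res_d P k x.
  apply: fac_inj => // y; case: k y => [|k] y; apply/iE => /=.
    by apply/res_exact0; exists y.
  by apply/res_exactS; exists y.
pose c k := projT1 (cid (cex k)).
have cE k x : i k (c k x) = res_d P k x by exact: (projT2 (cid (cex k)) x).
pose S k : lmodType A := if k is k'.+1 then K k' else M.
pose cv k : {linear P k -> S k} :=
  match k return {linear P k -> S k} with 0 => res_aug P | k'.+1 => c k' end.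
have ss k : ses (i k : {linear S k.+1 -> P k}) (cv k).
  split.
  - by move=> u iu0; apply: injI; rewrite iu0 linear0.
  - case: k => [|k] w; first exact: res_aug_surj.
    have [x xE] : exists x, res_d P k x = i k w.
      case: k w => [|k] w.
        by apply/res_exact0; apply/(iE 0%N); exists w.
      by apply/res_exactS; apply/(iE k.+1); exists w.
    by exists x; apply: injI; rewrite cE.
  - move=> u; case: k u => [|k] u; first by apply/(iE 0%N); exists u.
    by apply: injI; rewrite linear0 cE; apply/(iE k.+1); exists u.
  - move=> v; case: k v => [|k] v h; first by apply/(iE 0%N).
    by apply/(iE k.+1); rewrite -cE h linear0.
exists (Res ss (@res_projective _ _ P)); split=> // h.
have [|g gE] := extP (h \o c n).
  move=> x /=; have -> : c n (res_d P n.+1 x) = 0; last by rewrite linear0.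
  by apply: injI; rewrite cE linear0; apply/res_exactS; exists x.
exists g => u; have [x <-] := ses_surj (ss n.+1) u.
by rewrite /= cE -gE.
Qed.

Section Exists.
Variable C : lmodType A -> Prop.

Record proj_cover U := ProjCover {
  cker : lmodType A; cpr : lmodType A;
  cinc : {linear cker -> cpr}; ccov : {linear cpr -> U};
  cover_ses : ses cinc ccov;
  cover_proj : projective cpr;
  cover_fg : fin_gen cpr;
  cker_fg : fin_gen cker;
  cover_C : C cker }.

Hypothesis covers : forall U, fin_gen U -> exists c : proj_cover U, True.

(** The condition [C] carries the extra property of the syzygies of a minimal
    resolution. *)
Lemma fgres_exists M : fin_gen M -> exists r : res,
  [/\ sy r 0 = M, fgres r & forall n, C (sy r n.+1)].
Proof.
move=> fM; pose T := {U : lmodType A | fin_gen U}.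
pose cv (U : T) := projT1 (cid (covers (svalP U))).
pose fix s n : T := if n is n'.+1 then exist _ _ (cker_fg (cv (s n'))) else exist _ M fM.
exists (@Res (fun n => sval (s n)) (fun n => cpr (cv (s n))) (fun n => cinc (cv (s n)))
  (fun n => ccov (cv (s n))) (fun n => cover_ses (cv (s n))) (fun n => @cover_proj _ (cv (s n)))).
by split=> // n; [apply: cover_fg | apply: (cover_C (cv (s n)))].
Qed.

End Exists.

(** The middle term of the horseshoe lemma is built degree by degree; the state
    of the recursion is an extension of the syzygies of the two ends. *)
Record extension U W := Extension {
  hV : lmodType A;
  hi : {linear U -> hV};
  hp : {linear hV -> W};
  hses : ses hi hp }.

Record horseshoe_step U W P' P'' U' W' (i' : {linear U' -> P'}) (c' : {linear P' -> U})
    (i'' : {linear W' -> P''}) (c'' : {linear P'' -> W}) (s : extension U W) := HorseshoeStep {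
  hnext : extension U' W';
  hj : {linear hV hnext -> (P' * P'')%type};
  hc : {linear (P' * P'')%type -> hV s};
  hjc : ses hj hc;
  hc_l : forall x, hc (x, 0) = hi s (c' x);
  hp_c : forall x, hp s (hc x) = c'' x.2;
  hj_i : forall u, hj (hi hnext u) = (i' u, 0);
  hj_2 : forall v, (hj v).2 = i'' (hp hnext v) }.

(** The projective of the middle term is [P' * P''], mapped by the cover of [U]
    and by a lift of the cover of [W]; the snake lemma makes its kernel an
    extension of [W'] by [U']. *)
Lemma horseshoe_step_exists U W P' P'' U' W' (i' : {linear U' -> P'}) (c' : {linear P' -> U})
    (i'' : {linear W' -> P''}) (c'' : {linear P'' -> W}) (s : extension U W) :
  ses i' c' -> ses i'' c'' -> projective P'' ->
  exists t : horseshoe_step i' c' i'' c'' s, True.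
Proof.
move=> s' s'' pP''; have ss := hses s.
have [sg sgE] := pP'' _ _ (hp s) c'' (ses_surj ss).
pose c := lcopair (hi s \o c') sg.
have c_l x : c (x, 0) = hi s (c' x) by rewrite /= /lcopair_fun /= linear0 addr0.
have p_c x : hp s (c x) = c'' x.2.
  by rewrite /= /lcopair_fun linearD /= (ses_comp ss) add0r sgE.
have [|K [j sj]] := @kernel_exists A _ _ c.
  move=> v; have [y yE] := ses_surj s'' (hp s v).
  have [|u uE] := ses_exact ss (v := v - sg y); first by rewrite linearB sgE yE subrr.
  have [x xE] := ses_surj s' u; exists (x, y).
  by rewrite /= /lcopair_fun /= xE uE subrK.
have [|h hE] := @fac_inj A _ _ _ j (lpair i' \0) (ses_injective sj).
  by move=> u; apply: (ses_exact sj); rewrite c_l (ses_comp s') linear0.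
have [|q qE] := @fac_inj A _ _ _ i'' (snd \o j) (ses_injective s'').
  by move=> u; apply: (ses_exact s''); rewrite /= -p_c (ses_comp sj) linear0.
have st : ses h q.
  split.
  - move=> u hu; apply: (ses_inj s'); have := hE u; rewrite hu linear0.
    by move=> [<-].
  - move=> w; have [|u uE] := ses_exact ss (v := sg (i'' w)).
      by rewrite sgE (ses_comp s'').
    have [x xE] := ses_surj s' u.
    have [|v vE] := ses_exact sj (v := (- x, i'' w)).
      by rewrite /= /lcopair_fun /= !linearN xE uE addNr.
    by exists v; apply: (ses_injective s''); rewrite qE /= vE.
  - by move=> u; apply: (ses_injective s''); rewrite qE /= hE linear0.
  - move=> v qv; have v2 : (j v).2 = 0 by rewrite -[(j v).2]/((snd \o j) v) -qE qv linear0.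
    have jv : j v = ((j v).1, 0) by rewrite -v2; case: (j v).
    have [|u uE] := ses_exact s' (v := (j v).1).
      apply: (ses_inj ss); rewrite -c_l -jv; exact: ses_comp sj v.
    by exists u; apply: (ses_injective sj); rewrite hE jv -uE.
by unshelve eexists; first exists (Extension st) j c.
Qed.

Section Horseshoe.
Variables r' r'' : res.

(** Keeping the projectives of the middle resolution equal to products on the
    nose lets maps defined on one factor be extended by zero. *)
Record horseshoe V := Horseshoe {
  hst : forall n, extension (sy r' n) (sy r'' n);
  hinc : forall n, {linear hV (hst n.+1) -> (pr r' n * pr r'' n)%type};
  hcov : forall n, {linear (pr r' n * pr r'' n)%type -> hV (hst n)};
  hses_n : forall n, ses (hinc n) (hcov n);
  hcov_l : forall n x, hcov n (x, 0) = hi (hst n) (cov r' n x);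
  hp_cov : forall n x, hp (hst n) (hcov n x) = cov r'' n x.2;
  hinc_i : forall n u, hinc n (hi (hst n.+1) u) = (inc r' n u, 0);
  hinc_2 : forall n v, (hinc n v).2 = inc r'' n (hp (hst n.+1) v);
  hst0 : hV (hst 0) = V }.

Definition hres V (H : horseshoe V) : res :=
  Res (hses_n H) (fun n => projective_prod (res_proj r' n) (res_proj r'' n)).

Lemma horseshoe_exists V (i : {linear sy r' 0 -> V}) (p : {linear V -> sy r'' 0}) :
  ses i p -> exists H : horseshoe V, True.
Proof.
move=> s0.
pose nx n (s : extension (sy r' n) (sy r'' n)) :=
  projT1 (cid (horseshoe_step_exists s (res_ses r' n) (res_ses r'' n) (res_proj r'' n))).
pose fix st n : extension (sy r' n) (sy r'' n) :=
  if n is n'.+1 then hnext (nx n' (st n')) else Extension s0.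
unshelve eexists; last by [].
exists st (fun n => hj (nx n (st n))) (fun n => hc (nx n (st n))) => //.
- by move=> n; apply: hjc.
- by move=> n; apply: hc_l.
- by move=> n; apply: hp_c.
- by move=> n; apply: hj_i.
- by move=> n; apply: hj_2.
Qed.

Lemma hi_lifts V (H : horseshoe V) : @lifts r' (hres H) (fun n => hi (hst H n)).
Proof.
move=> n; exists (linl (pr r' n) (pr r'' n)); split=> [x|u] /=.
  exact: hcov_l.
by rewrite hinc_i.
Qed.

End Horseshoe.

(** Finite direct sums indexed by a sequence, multiplicities being repetitions;
    sums of resolutions are then resolutions by computation. *)
Section BigProd.
Variable I : Type.

Definition triv_mod : lmodType A := 'rV[A]_0.

Fixpoint bp (G : I -> lmodType A) (l : seq I) : lmodType A :=
  if l is a :: l' then (G a * bp G l')%type else triv_mod.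

Fixpoint bpmap (G H : I -> lmodType A) (f : forall a, {linear G a -> H a}) l :
    {linear bp G l -> bp H l} :=
  match l return {linear bp G l -> bp H l} with
  | [::] => idfun
  | a :: l' => lprod (f a) (bpmap f l')
  end.

Lemma triv_mod0 (x : triv_mod) : x = 0.
Proof. by apply/rowP => -[]. Qed.

Lemma bp_ses (G H K : I -> lmodType A) (f : forall a, {linear G a -> H a})
    (g : forall a, {linear H a -> K a}) l :
  (forall a, ses (f a) (g a)) -> ses (bpmap f l) (bpmap g l).
Proof.
move=> s; elim: l => [|a l IH] /=; last exact: ses_prod.
split=> //=; first by move=> w; exists w.
- by move=> u; apply: triv_mod0.
- by move=> v _; exists v.
Qed.

Lemma bp_proj (G : I -> lmodType A) l : (forall a, projective (G a)) -> projective (bp G l).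
Proof.
move=> pG; elim: l => [|a l IH] /=; last exact: projective_prod.
exact: projective_free.
Qed.

Lemma bp_fg (G : I -> lmodType A) l : (forall a, fin_gen (G a)) -> fin_gen (bp G l).
Proof.
move=> fG; elim: l => [|a l IH] /=; last exact: fin_gen_prod.
exact: fin_gen_free.
Qed.

Variable r : I -> res.

Definition bpres (l : seq I) : res :=
  @Res (fun n => bp (fun a => sy (r a) n) l) (fun n => bp (fun a => pr (r a) n) l)
    (fun n => bpmap (fun a => inc (r a) n) l) (fun n => bpmap (fun a => cov (r a) n) l)
    (fun n => bp_ses l (fun a => res_ses (r a) n))
    (fun n => @bp_proj _ l (fun a => res_proj (r a) n)).

Lemma fgres_bp l : (forall a, fgres (r a)) -> fgres (bpres l).
Proof. by move=> fr n; apply: bp_fg => a; apply: fr. Qed.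

End BigProd.

End Resolutions.

Arguments res_proj [A] r n _ _ _ _ _ : rename.

(** * Lengths of Hom and Ext *)

Section HomLength.
Variables (A : pzRingType) (R : Type) (phi : R -> A).
Hypothesis phiC : forall r a, phi r * a = a * phi r.
Implicit Types U V W Y : lmodType A.

Definition actm Y (r : R) (y : Y) : Y := phi r *: y.
Definition actf (U : Type) Y (r : R) (f : U -> Y) : U -> Y := fun u => phi r *: f u.

Definition Hom U Y : set (U -> Y) := [set f : U -> Y | exists g : {linear U -> Y}, f = g :> (U -> Y)].

Lemma HomP U Y (g : {linear U -> Y}) : Hom (g : U -> Y).
Proof. by exists g. Qed.

Lemma opsub_Hom U Y : opsub (@actf U Y) (@Hom U Y).
Proof.
split.
- by exists (\0 : {linear U -> Y}).
- by move=> _ _ [f ->] [g ->]; exists (f \- g).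
- move=> r _ [f ->]; have fL : linear (actf r f).
    move=> a x y; rewrite /actf linearP scalerDr !scalerA; congr (_ *: _ + _).
    by rewrite phiC.
  by exists (mklin fL).
Qed.

Lemma actf0 (U : Type) Y r : actf r (0 : U -> Y) = 0.
Proof. by apply/funext => u; rewrite /actf scaler0. Qed.

Definition hlen U Y := len (@actf U Y) (@Hom U Y).

Definition extendible U V Y (i : {linear U -> V}) : set (U -> Y) :=
  (fun f : V -> Y => f \o i) @` @Hom V Y.

Arguments extendible {U V} Y i.

Definition len_extendible U V Y (i : {linear U -> V}) := len (@actf U Y) (extendible Y i).

Lemma opsub_extendible U V Y (i : {linear U -> V}) : opsub (@actf U Y) (extendible Y i).
Proof. exact: (@opsub_im _ _ _ (@actf V Y) (@actf U Y)) (@opsub_Hom V Y). Qed.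

Lemma extendible_sub U V Y (i : {linear U -> V}) : extendible Y i `<=` @Hom U Y.
Proof. by move=> _ [_ [f ->] <-]; exists (f \o i). Qed.

Lemma extendibleP U V Y (i : {linear U -> V}) (f : {linear U -> Y}) :
  extendible Y i f <-> ext_to i f.
Proof.
split=> [[_ [g ->] e]|[g gE]]; first by exists g => u; rewrite -[RHS]/((f : U -> Y) u) -e.
by exists (g : V -> Y); [apply: HomP | apply/funext].
Qed.

Variable Y : lmodType A.
Hypothesis finY : fin_len (@actm Y) setT.

Lemma fin_Hom U : fin_gen U -> fin_len (@actf U Y) (@Hom U Y).
Proof.
move=> [n [g gE]].
apply: (@fin_joint _ _ _ (@actf U Y) (@actm Y) _ n (fun i f => f (g i)) setT) => //.
- by move=> r; rewrite /actm scaler0.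
- exact: opsub_Hom.
move=> _ [f ->] f0; apply/funext => u; have [c ->] := gE u.
by rewrite linear_sum big1 // => i _; rewrite linearZZ f0 scaler0.
Qed.

(** Left exactness of [Hom(-, Y)]; the last term measures the maps on [U] that
    survive to [V]. *)
Lemma hlen_ses U V W (i : {linear U -> V}) (p : {linear V -> W}) : ses i p -> fin_gen V ->
  hlen V Y = (hlen W Y + len_extendible Y i)%N.
Proof.
move=> s fV; have fW : fin_gen W by apply: fin_gen_surj (ses_surj s) fV.
rewrite /hlen (@len_map _ _ _ (@actf V Y) (@actf U Y) (fun f => f \o i)) //.
- congr (_ + _)%N.
  rewrite -(@len_inj _ _ _ (@actf W Y) (@actf V Y) (fun f => f \o p)) //.
  + congr (len _ _); apply/seteqP; split=> [f [[g ->] gi]|f [_ [g ->] <-]].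
      have [|h hE] := @fac_surj A _ _ _ p g (ses_surj s).
        move=> v /(ses_exact s)[u <-].
        by have := congr1 (fun f => f u) gi.
      by exists (h : W -> Y); [apply: HomP | apply/funext].
    split; first by exists (g \o p).
    by apply/funext => u /=; rewrite (ses_comp s) linear0.
  + exact: actf0.
  + exact: actf0.
  + exact: opsub_Hom.
  + exact: fin_Hom.
  + move=> f _ fp; apply/funext => w; have [v <-] := ses_surj s w.
    by have := congr1 (fun f => f v) fp.
- exact: actf0.
- exact: opsub_Hom.
- exact: fin_Hom.
Qed.

Lemma len_extendible_le U V (i : {linear U -> V}) : fin_gen U -> (len_extendible Y i <= hlen U Y)%N.
Proof.
move=> fU; apply: len_le; [exact: opsub_extendible | exact: opsub_Hom | exact: extendible_sub |].
exact: fin_Hom.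
Qed.

Lemma len_extendible_full U V (i : {linear U -> V}) : fin_gen U ->
  len_extendible Y i = hlen U Y <-> forall f : {linear U -> Y}, ext_to i f.
Proof.
move=> fU; split=> [e f|ext].
  apply/extendibleP; suff -> : extendible Y i = @Hom U Y by exact: HomP.
  apply: len_eq_sub e; [exact: opsub_extendible | exact: opsub_Hom | exact: extendible_sub |].
  exact: fin_Hom.
congr (len _ _); apply/seteqP; split; first exact: extendible_sub.
by move=> _ [f ->]; apply/extendibleP.
Qed.

Lemma hlen_prod U V : fin_gen U -> fin_gen V -> hlen (U * V)%type Y = (hlen U Y + hlen V Y)%N.
Proof.
move=> fU fV; have s : ses (linl U V) (snd : {linear (U * V)%type -> V}).
  split=> //.
  - by move=> u [].
  - by move=> w; exists (0, w).
  - by case=> u w /= ->; exists u.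
rewrite (hlen_ses s); last exact: fin_gen_prod.
rewrite addnC; congr (_ + _)%N; apply/len_extendible_full => // f.
by exists (f \o fst).
Qed.

Lemma hlen0 : hlen (triv_mod A) Y = 0%N.
Proof.
rewrite /hlen -[RHS](@len0 _ _ (@actf (triv_mod A) Y)); last exact: actf0.
congr (len _ _); apply/seteqP; split=> [_ [f ->]|_ ->]; last by case: (opsub_Hom (triv_mod A) Y).
by apply/funext => x; rewrite (triv_mod0 x) linear0.
Qed.

(** The length of [Ext^(n+1)] with values in [Y]: by left exactness, the part of
    [Hom(sy r n.+1, Y)] that comes from the projective has length
    [hlen (pr r n) Y - hlen (sy r n) Y]. *)
Definition elen (r : res A) n : int :=
  (hlen (sy r n.+1) Y)%:Z + (hlen (sy r n) Y)%:Z - (hlen (pr r n) Y)%:Z.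

Lemma hlen_bp (I : Type) (G : I -> lmodType A) l : (forall a, fin_gen (G a)) ->
  hlen (bp G l) Y = (\sum_(a <- l) hlen (G a) Y)%N.
Proof.
move=> fG; elim: l => [|a l IH]; first by rewrite big_nil hlen0.
by rewrite big_cons -IH; apply: hlen_prod => //; apply: bp_fg.
Qed.

Lemma elen_bp (I : Type) (r : I -> res A) l n : (forall a, fgres (r a)) ->
  elen (bpres r l) n = \sum_(a <- l) elen (r a) n.
Proof.
move=> fr; have fs m a : fin_gen (sy (r a) m) by apply: fgres_sy.
rewrite /elen /= !hlen_bp //; last by move=> a; apply: fr.
by elim: l => [|a l IH]; rewrite ?big_nil ?big_cons; lia.
Qed.

Section HorseLength.
Variables (r' r'' : res A) (V : lmodType A) (H : horseshoe r' r'' V).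
Hypotheses (f' : fgres r') (f'' : fgres r'').

Let i n := hi (hst H n).
Let p n := hp (hst H n).
Let s n : ses (i n) (p n) := hses (hst H n).

(** The extension [r' -> V -> r''] in degree [n], rotated: its left end is the
    next syzygy of the right end, mapped by minus the connecting lift. *)
Lemma rotate n : exists t : {linear sy r'' n.+1 -> sy r' n},
  [/\ ses (lpair t (inc r'' n)) (lcopair (i n) (hcov H n \o linr (pr r' n) (pr r'' n))) &
      forall v, t (p n.+1 v) = cov r' n (hinc H n v).1].
Proof.
have [|t tE] := @fac_inj A _ _ _ (i n) (\- (hcov H n \o linr (pr r' n) (pr r'' n) \o inc r'' n))
  (ses_injective (s n)).
  move=> w; apply: (ses_exact (s n)).
  by rewrite linearN /= hp_cov /= (ses_comp (res_ses r'' n)) oppr0.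
exists t; split.
  split.
  - by move=> w [_ /(ses_inj (res_ses r'' n))].
  - move=> v; have [[x y] <-] := ses_surj (hses_n H n) v.
    exists (cov r' n x, y); rewrite /= /lcopair_fun /= /i -hcov_l -linearD.
    by congr (hcov H n _); congr (_, _) => /=; rewrite ?addr0 ?add0r.
  - by move=> w; rewrite /= /lcopair_fun /= tE /= addNr.
  - case=> u y; rewrite /= /lcopair_fun /= => e.
    have [|w wE] := ses_exact (res_ses r'' n) (v := y).
      have := congr1 (p n) e; rewrite linear0 linearD (ses_comp (s n)) add0r.
      by rewrite /p hp_cov.
    exists w; rewrite /= /lpair_fun /= wE; congr (_, _).
    apply: (ses_injective (s n)); rewrite tE /= wE; apply/eqP.
    by rewrite eq_sym -subr_eq0 opprK; apply/eqP.
move=> v; apply: (ses_injective (s n)); rewrite tE /= -hinc_2 /i -hcov_l.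
apply/eqP; rewrite eq_sym -subr_eq0 opprK -linearD; apply/eqP.
rewrite -[RHS](ses_comp (hses_n H n) v); congr (hcov H n _).
by rewrite [RHS]surjective_pairing; congr (_, _) => /=; rewrite ?addr0 ?add0r.
Qed.

(** The map [Ext^(n+1)(V, Y) -> Ext^(n+1)(U', Y)] induced by the inclusion of
    [U' = sy r' 0] is zero. *)
Definition restr_zero n := forall f : {linear sy (hres H) n.+1 -> Y},
  ext_to (inc r' n) (f \o (i n.+1 : {linear _ -> sy (hres H) n.+1})).

(** The map [Ext^(n+1)(U'', Y) -> Ext^(n+1)(V, Y)] induced by the projection onto
    [U'' = sy r'' 0] is zero. *)
Definition infl_zero n := forall f : {linear sy r'' n.+1 -> Y},
  ext_to (inc (hres H) n) (f \o (p n.+1 : {linear sy (hres H) n.+1 -> _})).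

(** Along the rotated sequence this condition becomes an extension property, which
    [len_extendible_full] turns into an equality of lengths. *)
Lemma infl_zeroP n (t : {linear sy r'' n.+1 -> sy r' n}) :
  (forall v, t (p n.+1 v) = cov r' n (hinc H n v).1) ->
  infl_zero n <-> forall f : {linear sy r'' n.+1 -> Y}, ext_to (lpair t (inc r'' n)) f.
Proof.
move=> tE; split=> ext f.
  have [G GE] := ext f.
  have [|G1 G1E] := @fac_surj A _ _ _ (cov r' n) (G \o linl _ _) (ses_surj (res_ses r' n)).
    move=> x /(ses_exact (res_ses r' n))[u <-] /=.
    rewrite -[LHS]/(G (inc r' n u, 0)) -(hinc_i H) -[LHS]/(G (inc (hres H) n _)) GE /=.
    by rewrite (ses_comp (s n.+1)) linear0.
  exists (lcopair G1 (G \o linr _ _)) => w; have [v <-] := ses_surj (s n.+1) w.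
  rewrite /= /lcopair_fun /= tE G1E /= -hinc_2 -linearD.
  rewrite -[RHS]/((f \o (p n.+1 : {linear sy (hres H) n.+1 -> _})) v) -GE.
  congr (G _); rewrite [RHS]surjective_pairing.
  by congr (_, _) => /=; rewrite ?addr0 ?add0r.
have [g gE] := ext f.
exists (g \o lprod (cov r' n) idfun) => v /=.
rewrite -[RHS]gE /=; congr (g _); rewrite /lpair_fun /= tE; congr (_, _).
exact: hinc_2.
Qed.

(** Exactness of
    [Ext^(n+1)(V) -> Ext^(n+1)(U') -> Ext^(n+2)(U'') -> Ext^(n+2)(V)] in lengths:
    [a] and [b] are the lengths of the images of the two outer maps. *)
Lemma elen_horse n : exists a b : nat,
  [/\ elen r' n - elen r'' n.+1 = a%:Z - b%:Z, a = 0%N <-> restr_zero n & b = 0%N <-> infl_zero n.+1].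
Proof.
have fs' m : fin_gen (sy r' m) by apply: fgres_sy.
have fs'' m : fin_gen (sy r'' m) by apply: fgres_sy.
have fV m : fin_gen (hV (hst H m)).
  by apply: (fin_gen_surj (ses_surj (hses_n H m))); apply: fin_gen_prod.
have [t [st tE]] := rotate n.+1.
pose j := lpair t (inc r'' n.+1).
have e1 := hlen_ses (res_ses r' n) (f' n).
have e2 := hlen_ses st (fin_gen_prod (fs' n.+1) (f'' n.+1)); rewrite hlen_prod // in e2.
have e3 := hlen_ses (s n.+1) (fV n.+1).
have le_im : extendible Y (inc r' n) `<=` extendible Y (i n.+1).
  move=> _ [_ [f ->] <-]; exists (f \o fst \o hinc H n).
    by exists (f \o fst \o hinc H n).
  by apply/funext => u /=; rewrite hinc_i.
have le1 : (len_extendible Y (inc r' n) <= len_extendible Y (i n.+1))%N.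
  apply: len_le le_im _; [exact: opsub_extendible | exact: opsub_extendible |].
  by apply: fin_sub (@extendible_sub _ _ _ _) (fin_Hom _) => //; apply: opsub_Hom.
have le2 := len_extendible_le j (fs'' n.+2).
exists (len_extendible Y (i n.+1) - len_extendible Y (inc r' n))%N, (hlen (sy r'' n.+2) Y - len_extendible Y j)%N; split.
- by rewrite /elen; move: e1 e2 e3 le1 le2; rewrite -/j; lia.
- split=> [e f|cR].
    have eqim : extendible Y (inc r' n) = extendible Y (i n.+1).
      apply: (len_eq_sub (@opsub_extendible _ _ _ _) (@opsub_extendible _ _ _ _) le_im).
        by apply: fin_sub (@extendible_sub _ _ _ _) (fin_Hom _) => //; apply: opsub_Hom.
      by rewrite -/(len_extendible _ _) -/(len_extendible _ _); lia.
    by apply/extendibleP; rewrite eqim; exists f; [apply: HomP | apply/funext].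
  suff e : extendible Y (i n.+1) = extendible Y (inc r' n) by rewrite /len_extendible e subnn.
  apply/seteqP; split=> // _ [_ [f ->] <-].
  by have := cR f => /extendibleP.
- rewrite (infl_zeroP tE) -len_extendible_full //; rewrite -/j; lia.
Qed.

End HorseLength.
End HomLength.

(** * Independence of the multiplicity vectors *)

Section Core.
Variables (A : pzRingType) (R : Type) (phi : R -> A).
Hypothesis phiC : forall r a, phi r * a = a * phi r.
Hypothesis finY : forall Y : lmodType A, fin_gen Y -> fin_len (@actm A R phi Y) setT.
Implicit Types U V W Y Q : lmodType A.

Lemma proj_coords (Q : lmodType A) : fin_gen Q -> projective Q ->
  exists n (s : {linear Q -> 'rV[A]_n}) (r : {linear 'rV[A]_n -> Q}), forall q, r (s q) = q.
Proof.
move=> /fin_gen_cover[n [r surjr]] pQ.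
by have [s sE] := pQ _ _ r (idfun : {linear Q -> Q}) surjr; exists n, s, r.
Qed.

Lemma ext_proj U V (i : {linear U -> V}) Q :
  (forall h : {linear U -> A^o}, ext_to i h) -> fin_gen Q -> projective Q ->
  forall h : {linear U -> Q}, ext_to i h.
Proof.
move=> extA fQ pQ h; have [n [s [r rs]]] := proj_coords fQ pQ.
have cL j : linear (fun u => s (h u) 0 j : A^o).
  by move=> a x y; rewrite !linearP !mxE.
pose g j := projT1 (cid (extA (mklin (cL j)))).
have gE j u : g j (i u) = s (h u) 0 j by exact: (projT2 (cid (extA (mklin (cL j)))) u).
have gL : linear (fun v => \row_j (g j v : A)).
  by move=> a x y; apply/rowP => j; rewrite !mxE linearP.
exists (r \o mklin gL) => u /=; rewrite -[RHS]rs; congr (r _).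
by apply/rowP => j; rewrite mxE gE.
Qed.

Lemma eq_iso V W : V = W -> exists (f : {linear V -> W}) (g : {linear W -> V}),
  (forall x, g (f x) = x) /\ (forall y, f (g y) = y).
Proof. by move=> <-; exists idfun, idfun. Qed.

Variable r : res A.
Hypothesis fr : fgres r.
Hypothesis extM : forall n (h : {linear sy r n.+1 -> sy r 0}), ext_to (inc r n) h.
Hypothesis extA : forall n (h : {linear sy r n.+1 -> A^o}), ext_to (inc r n) h.
Hypothesis nproj : ~ projective (sy r 0).

(** Because [Ext(M, A) = 0], a map from [X_(j+2)] to [X_(n+1)] extends to the
    ambient projectives, so it is induced on syzygies by a map from [X_(j+1)] to
    [X_n]; after [n] such steps one reaches the class of a self-extension
    of [M]. *)
Lemma ext_syzygy n j : (n <= j)%N ->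
  forall h : {linear sy r j.+1 -> sy r n}, ext_to (inc r j) h.
Proof.
elim: n j => [|n IH] [//|j] lenj h; try exact: extM.
have [G GE] := ext_proj (extA (n := j.+1)) (fr n) (res_proj r n) (inc r n \o h).
have [|hb hbE] := @fac_surj A _ _ _ (cov r j.+1) (cov r n \o G) (ses_surj (res_ses r j.+1)).
  move=> x /(ses_exact (res_ses r j.+1))[u <-] /=.
  by rewrite GE /= (ses_comp (res_ses r n)).
(* [hb] is the map whose syzygy is [h]. *)
have [b bE] := IH j lenj hb.
have [B BE] := res_proj r j _ _ _ b (ses_surj (res_ses r n)).
have [|g gE] := @fac_inj A _ _ _ (inc r n) (G \- (B \o (inc r j \o cov r j.+1)))
    (ses_injective (res_ses r n)).
  move=> x; apply: (ses_exact (res_ses r n)).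
  by rewrite /= linearB BE bE hbE /= subrr.
exists g => u; apply: (ses_injective (res_ses r n)).
by rewrite gE /= GE (ses_comp (res_ses r j.+1)) (linear0 (inc r j)) (linear0 B) subr0.
Qed.

(** The class of the identity of [X_(n+1)] in [Ext(X_n, X_(n+1))] is nonzero: if it
    vanishes, [X_n] is projective, and [Ext(M, A) = 0] carries this down to [M]. *)
Lemma syzygy_not_ext n : ~ ext_to (inc r n) (idfun : {linear sy r n.+1 -> sy r n.+1}).
Proof.
elim: n => [|n IH] [g gE].
  apply: nproj.
  have [|s sE] := @fac_surj A _ _ _ (cov r 0) (idfun \- (inc r 0 \o g)) (ses_surj (res_ses r 0)).
    by move=> x /(ses_exact (res_ses r 0))[u <-] /=; rewrite gE subrr.
  apply: (@projective_retract _ _ _ (cov r 0) s) (res_proj r 0) => q.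
  have [x <-] := ses_surj (res_ses r 0) q.
  by rewrite sE /= linearB (ses_comp (res_ses r 0)) subr0.
apply: IH; apply: ext_proj; [exact: extA | exact: fgres_sy |].
have [|s sE] := @fac_surj A _ _ _ (cov r n.+1) (idfun \- (inc r n.+1 \o g)) (ses_surj (res_ses r n.+1)).
  by move=> x /(ses_exact (res_ses r n.+1))[u <-] /=; rewrite gE subrr.
apply: (@projective_retract _ _ _ (cov r n.+1) s) (res_proj r n.+1) => q.
have [x <-] := ses_surj (res_ses r n.+1) q.
by rewrite sE /= linearB (ses_comp (res_ses r n.+1)) subr0.
Qed.

Section Level.
Variables (r' r'' : res A) (k : nat) (H : horseshoe r' r'' (sy r k)).
Hypotheses (f' : fgres r') (f'' : fgres r'').

Let r1 := shift_res r k.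
Let r2 := hres H.

(** The [n + 1]-st syzygy of the inclusion of [sy r' 0] extends to the projective
    that contains its source; this is stable vanishing in that degree. *)
Definition vanishes_at n := ext_to (inc r' n) (hi (hst H n.+1)).

Lemma level_vanish N n : (N <= n + k)%N ->
  forall h : {linear sy r2 n.+1 -> sy r N}, ext_to (inc r2 n) h.
Proof.
move=> leN; have [g [f [fK gK]]] := eq_iso (hst0 H).
apply: (@ext_transfer A r1 r2 f g) => // h.
exact: ext_syzygy.
Qed.

Lemma level_restr N n : (N <= n + k)%N -> restr_zero (sy r N) H n.
Proof.
move=> leN f; have [g gE] := level_vanish leN f.
by exists (g \o linl _ _) => u /=; rewrite -gE /= hinc_i.
Qed.

Lemma level_infl N n : (N <= n + k)%N -> infl_zero (sy r N) H n.
Proof. by move=> leN f; apply: level_vanish. Qed.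

Lemma vanishes_restr Y n : vanishes_at n -> restr_zero Y H n.
Proof. by move=> [g gE] f; exists (f \o g) => u /=; rewrite gE. Qed.

(** Restricting the class of the identity: a homotopy inverse of the comparison
    with [r] turns an extension of the restricted class into an extension of the
    inclusion itself. *)
Lemma nvanishes_restr n : ~ vanishes_at n -> ~ restr_zero (sy r (n.+1 + k)) H n.
Proof.
move=> good cR; apply: good; have [g [f [fK gK]]] := eq_iso (hst0 H).
have [al [be [_ _ _ ab]]] := @compare A r1 r2 f g gK fK.
have [b bE] := cR (be n.+1); have [c cE] := ab n.
exists ((al n.+1 \o b) \- (c \o linl _ _)) => u.
rewrite /= bE /= -[X in c X](hinc_i H); have := cE (hi (hst H n.+1) u).
by move=> ->; rewrite subKr.
Qed.

(** If the inclusion is stably zero, the class of the identity becomes zero on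
    [sy r' 0] and hence comes from [sy r'' 0]. *)
Lemma vanishes_infl n : vanishes_at n -> ~ infl_zero (sy r (n.+1 + k)) H n.
Proof.
move=> [g gE] cQ; have [g0 [f0 [fK gK]]] := eq_iso (hst0 H).
have [al [be [lal _ ba _]]] := @compare A r1 r2 f0 g0 gK fK.
pose th : {linear sy r2 n.+1 -> sy r (n.+1 + k)} := be n.+1.
pose b0 : {linear pr r2 n -> sy r (n.+1 + k)} := th \o (g \o fst).
have [|et etE] := @fac_surj A _ _ _ (hp (hst H n.+1)) (th \- (b0 \o hinc H n))
    (ses_surj (hses (hst H n.+1))).
  move=> v /(ses_exact (hses (hst H n.+1)))[u <-] /=.
  by rewrite hinc_i /= gE subrr.
have [q qE] := cQ et.
have thE v : th v = (b0 \+ q) (hinc H n v).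
  by have := qE v; rewrite /= etE /= => ->; rewrite addrC subrK.
have [a [_ aE]] := lal n; have [c cE] := ba n.
apply: (@syzygy_not_ext (n + k)).
exists (((b0 \+ q) \o a) \- c) => x.
have := cE x; rewrite -/th -[be n.+1 _]/(th _) thE => cx.
by rewrite /= -[a _]aE [X in _ - X]cx subKr.
Qed.

(** The leading position is shifted by [d = 0] or [d = 1], according to whether the
    inclusion survives in all degrees or is stably zero from degree [n0] on. *)
Lemma leading_term : exists d n0, (d <= 1)%N /\ forall n, (n0 <= n)%N ->
  (forall n', (n < n')%N ->
     elen phi (sy r (n.+1 + d + k)) r' n' = elen phi (sy r (n.+1 + d + k)) r'' n'.+1) /\
  elen phi (sy r (n.+1 + d + k)) r' n <> elen phi (sy r (n.+1 + d + k)) r'' n.+1.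
Proof.
have horse N n := @elen_horse A R phi phiC (sy r N) (finY (fgres_sy N fr)) r' r'' _ H f' f'' n.
have zero N n : restr_zero (sy r N) H n -> infl_zero (sy r N) H n.+1 ->
    elen phi (sy r N) r' n = elen phi (sy r N) r'' n.+1.
  move=> cR cQ; have [a [b [e aR bQ]]] := horse N n.
  by move: e; rewrite (proj2 aR cR) (proj2 bQ cQ); lia.
have [[n0 bad]|good] := pselect (exists n, vanishes_at n).
  exists 1%N, n0; split=> // n len0; rewrite addn1.
  have badn m : (n <= m)%N -> vanishes_at m.
    move=> lenm; apply: (lifts_ext_leq (hi_lifts H) _ bad); exact: leq_trans len0 lenm.
  split=> [n' ltn|].
    apply: zero; last by apply: level_infl; lia.
    by apply: vanishes_restr; apply: badn; apply: ltnW.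
  have [a [b [e aR bQ]]] := horse (n.+2 + k)%N n.
  have a0 : a = 0%N by apply/aR/vanishes_restr/badn.
  have b0 : b <> 0%N by move/bQ; apply: vanishes_infl; apply: badn.
  by move: e b0; rewrite a0; lia.
exists 0%N, 0%N; split=> // n _; rewrite addn0; split=> [n' ltn|].
  by apply: zero; [apply: level_restr | apply: level_infl]; lia.
have [a [b [e aR bQ]]] := horse (n.+1 + k)%N n.
have b0 : b = 0%N by apply/bQ/level_infl.
have a0 : a <> 0%N by move/aR; apply: nvanishes_restr => bad; apply: good; exists n.
by move: e a0; rewrite b0; lia.
Qed.

End Level.

Section Family.
Variables (s : nat) (F : 'I_s -> res A).
Hypothesis fF : forall a, fgres (F a).
Hypothesis dec : forall k, exists l' l'' (i : {linear sy (bpres F l') 0 -> sy r k.+1})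
  (p : {linear sy r k.+1 -> sy (bpres F l'') 0}), ses i p.

Definition multv (l : seq 'I_s) : 'rV[rat]_s := \sum_(a <- l) delta_mx 0 a.

Lemma multvE (l : seq 'I_s) (e : 'I_s -> int) n (u : 'I_n) (C : 'M[rat]_(s, n)) :
  (forall a, C a u = (e a)%:~R) -> (multv l *m C) 0 u = (\sum_(a <- l) e a)%:~R.
Proof.
move=> Ce; rewrite /multv mulmx_suml summxE rmorph_sum; apply: eq_bigr => a _.
by rewrite -rowE mxE Ce.
Qed.

(** The matrix of the values [<g_k, c_p>], for [2s + 1] odd [k] and the leading
    positions [p], is triangular with nonzero diagonal, but factors through a
    space of dimension [2s]. *)
Lemma no_family : False.
Proof.
pose T := (s + s).+1.
have dt (t : nat) : exists L : seq 'I_s * seq 'I_s, exists d n0, (d <= 1)%N /\ forall n, (n0 <= n)%N ->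
  (forall n', (n < n')%N ->
     elen phi (sy r (n.+1 + d + t.*2.+1)) (bpres F L.1) n' =
     elen phi (sy r (n.+1 + d + t.*2.+1)) (bpres F L.2) n'.+1) /\
  elen phi (sy r (n.+1 + d + t.*2.+1)) (bpres F L.1) n <>
  elen phi (sy r (n.+1 + d + t.*2.+1)) (bpres F L.2) n.+1.
  have [l' [l'' [i [p ip]]]] := dec t.*2; exists (l', l'').
  have [H _] := @horseshoe_exists A (bpres F l') (bpres F l'') _ i p ip.
  by apply: (leading_term H); apply: fgres_bp.
have [L /choice[d /choice[n0 dn]]] := choice dt.
have d1 t : (d t <= 1)%N by have [] := dn t.
have lead t := proj2 (dn t).
(* Beyond all thresholds [n0 t], with room for the [T] leading positions. *)
pose N := (\max_(t < T) n0 t + T.*2 + 2)%N.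
(* Strictly decreasing in [t]: the shifts [d t] are at most 1, the indices
   [t.*2.+1] of the syzygies grow by 2. *)
pose n t := (N - (d t + t.*2.+2))%N.
have nN (t : 'I_T) : ((n t).+1 + d t + t.*2.+1 = N)%N.
  by rewrite /n /N; have := ltn_ord t; have := d1 t; lia.
have n0n (t : 'I_T) : (n0 t <= n t)%N.
  have : (n0 t <= \max_(t < T) n0 t)%N by exact: (leq_bigmax t).
  by rewrite /n /N; have := ltn_ord t; have := d1 t; lia.
pose Y := sy r N.
pose e a m : int := elen phi Y (F a) m.
have fY := finY (fgres_sy N fr).
pose C : 'M[rat]_(s + s, T) := col_mx (\matrix_(a, u) (e a (n u))%:~R)
   (\matrix_(a, u) (e a (n u).+1)%:~R).
pose G : 'M[rat]_(T, s + s) := \matrix_(t < T) row_mx (multv (L t).1) (- multv (L t).2).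
have GC t u : (G *m C) t u = (elen phi Y (bpres F (L t).1) (n u)
    - elen phi Y (bpres F (L t).2) (n u).+1)%:~R.
  have -> : (G *m C) t u = (row t (G *m C)) 0 u by rewrite [RHS]mxE.
  rewrite row_mul rowK mul_row_col mulNmx [LHS]mxE [X in _ + X]mxE.
  rewrite (@multvE _ (fun a => e a (n u))); last by move=> a; rewrite mxE.
  rewrite (@multvE _ (fun a => e a (n u).+1)); last by move=> a; rewrite mxE.
  by rewrite !elen_bp // rmorphB.
have trig : is_trig_mx (G *m C)^T.
  apply/is_trig_mxP => i j ltij; rewrite mxE GC; apply/eqP.
  rewrite intr_eq0 subr_eq0; apply/eqP.
  have [+ _] := lead j (n j) (n0n j); rewrite nN; apply.
  by have := nN i; have := nN j; have := d1 i; have := d1 j; lia.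
have unitE : \det (G *m C) != 0.
  rewrite -det_tr det_trig //; apply/prodf_neq0 => t _.
  rewrite mxE GC intr_eq0 subr_eq0; apply/eqP.
  by have [_] := lead t (n t) (n0n t); rewrite nN.
have := mulmx_max_rank G C.
by rewrite mxrank_unit ?ltnn // unitmxE unitfE.
Qed.

End Family.
End Core.

(** * Modules over an Artin algebra *)

Section FiniteLength.
Variables (A : pzRingType) (R : comPzRingType) (phi : {rmorphism R -> A}).
Hypothesis artR : artinian R.
Hypothesis phiC : forall r a, phi r * a = a * phi r.
Hypothesis genA : exists (n : nat) (g : 'I_n -> A),
  forall a, exists c : 'I_n -> R, a = \sum_(i < n) phi (c i) * g i.
Implicit Types U V W X Y : lmodType A.

Let act Y := @actm A R phi Y.

Lemma actm0 Y r : act r (0 : Y) = 0.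
Proof. exact: scaler0. Qed.

Lemma actm_opsub Y (S : set Y) : opsub *:%R S -> opsub (@act Y) S.
Proof. by move=> [S0 SB SA]; split=> // r x; apply: SA. Qed.

(** A finitely generated module over [A] is a quotient of a finite power
    of [R]. *)
Lemma fin_actm Y : fin_gen Y -> fin_len (@act Y) setT.
Proof.
move=> [m [y yE]]; have [n [g gE]] := genA.
pose I := ('I_m * 'I_n)%type.
pose aR r (f : I -> R) : I -> R := fun x => r * f x.
pose f (c : I -> R) : Y := \sum_(x : I) phi (c x) *: (g x.2 *: y x.1).
have finR : fin_len (fun r x : R => r * x) setT by apply: artinian_fin_len.
have finI : fin_len aR setT.
  have h0 (r : R) : (fun r x : R => r * x) r 0 = 0 by exact: mulr0.
  apply: (@fin_joint R (I -> R) R aR (fun r x : R => r * x) h0 #|{: I}|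
    (fun i (c : I -> R) => c (enum_val i)) setT) => //.
  by move=> c _ c0; apply/funext => x; rewrite -[x]enum_rankK c0.
have -> : [set: Y] = f @` setT.
  apply/seteqP; split=> // v _; have [a ->] := yE v.
  have /choice[c cE] := fun j => gE (a j).
  exists (fun x => c x.1 x.2) => //.
  rewrite /f -(pair_bigA _ (fun j i => phi (c j i) *: (g i *: y j))) /=.
  apply: eq_bigr => j _; rewrite [in RHS](cE j) scaler_suml.
  by apply: eq_bigr => i _; rewrite scalerA.
apply: (@fin_im _ _ _ aR (@act Y)) finI => //.
- move=> c d; rewrite /f -sumrB; apply: eq_bigr => x _.
  by rewrite rmorphB scalerBl.
- move=> r c; rewrite /f /act /actm scaler_sumr; apply: eq_bigr => x _.
  by rewrite /aR rmorphM -scalerA.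
- exact: actm0.
Qed.

Definition mod_len Y := len (@act Y) setT.

Lemma lin_act U V (f : {linear U -> V}) r x : f (act r x) = act r (f x).
Proof. exact: linearZZ. Qed.

Lemma mod_len_ses U V W (i : {linear U -> V}) (p : {linear V -> W}) :
  ses i p -> fin_gen V -> fin_gen U -> mod_len V = (mod_len U + mod_len W)%N.
Proof.
move=> s fV fU; have fW := fin_gen_surj (ses_surj s) fV.
have pB x y : p (x - y) = p x - p y by rewrite linearB.
have oV : opsub (@act V) setT by [].
rewrite [mod_len U]/mod_len [mod_len W]/mod_len.
rewrite /mod_len -/act (len_map pB (@lin_act V W p) (@actm0 W) oV (fin_actm fV)).
have -> : range p = setT.
  by apply/seteqP; split=> // w _; have [v <-] := ses_surj s w; exists v.
congr (_ + _)%N.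
rewrite -(@len_inj _ _ _ (@act U) (@act V) i) //.
- congr (len _ _); apply/seteqP; split=> [v [_ /(ses_exact s)[u <-]]|_ [u _ <-]].
    by exists u.
  by split=> //; apply: (ses_comp s).
- by move=> x y; rewrite linearB.
- exact: lin_act.
- exact: actm0.
- exact: actm0.
- exact: fin_actm.
- by move=> u _; apply: (ses_inj s).
Qed.

Lemma opsub_range U V (f : {linear U -> V}) : opsub *:%R (range f).
Proof.
apply: (@opsub_im _ _ _ (fun a x => a *: x) (fun a x => a *: x) f) => //.
- by move=> x y; rewrite linearB.
- by move=> a x; rewrite linearZZ.
Qed.

Lemma fin_gen_reg : fin_gen (A^o : lmodType A).
Proof.
exists 1%N, (fun _ => 1) => x; exists (fun _ => x).
by rewrite big_ord1 /GRing.scale /= mulr1.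
Qed.

Lemma orbitL X (x : X) : linear (fun a : A^o => (a : A) *: x).
Proof. by move=> a b c; rewrite scalerDl scalerA. Qed.

Definition orbit_map X (x : X) : {linear A^o -> X} := mklin (orbitL x).

(** A finitely generated submodule of [U] of greatest length is all of [U]. *)
Lemma fin_gen_sub U V (i : {linear U -> V}) : injective i -> fin_gen V -> fin_gen U.
Proof.
move=> injI fV; pose P n := exists W (p : {linear W -> U}),
  fin_gen W /\ len (@act V) (range (i \o p)) = n.
have exP : exists n, `[< P n >].
  exists (len (@act V) (range (i \o (\0 : {linear A^o -> U})))).
  by apply/asboolP; exists A^o, \0; split=> //; exact: fin_gen_reg.
have bnd n : `[< P n >] -> (n <= mod_len V)%N.
  move=> /asboolP[W [p [_ <-]]]; apply: len_le => //; last exact: fin_actm.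
  exact/actm_opsub/opsub_range.
case: (ex_maxnP exP bnd) => n /asboolP[W [p [fW <-]]] maxn.
apply: (fin_gen_surj (p := p) _ fW) => u.
pose q := lcopair p (orbit_map u).
have sub : range (i \o p) `<=` range (i \o q).
  move=> _ [w _ <-]; exists (w, 0) => //.
  by rewrite /= /lcopair_fun /= scale0r addr0.
have e : range (i \o p) = range (i \o q).
  have fin : fin_len (@act V) (range (i \o q)).
    by apply: (@fin_sub _ _ (@act V) _ setT) => //; apply: fin_actm.
  have o1 : opsub (@act V) (range (i \o p)) by exact/actm_opsub/opsub_range.
  have o2 : opsub (@act V) (range (i \o q)) by exact/actm_opsub/opsub_range.
  apply: (len_eq_sub o1 o2 sub fin); apply/eqP.
  rewrite eqn_leq (len_le o1 o2 sub fin) /=.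
  apply: maxn; apply/asboolP; exists (W * A^o)%type, q; split=> //.
  by apply: fin_gen_prod => //; apply: fin_gen_reg.
have : range (i \o p) (i u).
  by rewrite e; exists (0, 1) => //; rewrite /= /lcopair_fun /= linear0 add0r scale1r.
by move=> [w _ /injI <-]; exists w.
Qed.

Lemma left_ideal_opsub (L : {pred A}) :
  left_ideal L -> opsub *:%R ([set x | x \in L] : set A^o).
Proof.
move=> lL; have [L0 LB] := left_ideal_zmod lL.
by split=> // a x; apply: left_idealM.
Qed.

Lemma maximal_left_ideal_coset (L : {pred A}) (b c : A) : maximal_left_ideal L -> b \notin L ->
  exists a, c - a * b \in L.
Proof.
move=> [lL LnT Lmax] bL.
pose K : {pred A} := fun x => `[< exists a, x - a * b \in L >].
have [L0 LB] := left_ideal_zmod lL; have [_ Lin] := lL.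
have lK : left_ideal K.
  split; first by apply/asboolP; exists 0; rewrite mul0r subr0.
  move=> r x y /asboolP[a aE] /asboolP[a' aE']; apply/asboolP; exists (r * a + a').
  have := Lin r _ _ aE aE'; rewrite /GRing.scale /= mulrBr mulrDl mulrA.
  by rewrite opprD addrACA.
have sLK : {subset L <= K}.
  by move=> x xL; apply/asboolP; exists 0; rewrite mul0r subr0.
have bK : b \in K by apply/asboolP; exists 1; rewrite mul1r subrr.
have [eK|eK] := Lmax K lK sLK; first by rewrite eK (negPf bL) in bK.
by have /asboolP : c \in K by rewrite eK.
Qed.

(** Among the endomorphisms [f] of a free cover of [U] that lift the identity
    of [U], one with smallest image [S] restricts to an automorphism of [S],
    so [S] is a direct summand, and no smaller submodule of [S] covers [U].
    For each maximal left ideal [L] and coordinate [j], the kernel of [S -> U]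
    therefore lies in the submodule of vectors whose [j]-th entry is in [L]. *)
Lemma minimal_cover U : fin_gen U -> exists n (K Q : lmodType A) (k : {linear K -> Q})
    (p : {linear Q -> U}) (s : {linear Q -> 'rV[A]_n}),
  [/\ ses k p, projective Q, fin_gen Q, injective s &
      forall x j, s (k x) 0 j \in jacobson A].
Proof.
move=> fU; have [n [pi surjpi]] := fin_gen_cover fU.
pose F : lmodType A := 'rV[A]_n.
have fF : fin_gen F by apply: fin_gen_free.
have finS (S : set F) : fin_len (@act F) S.
  by apply: (@fin_sub _ _ (@act F) _ setT) => //; apply: fin_actm.
pose P (S : set F) := exists f : {linear F -> F}, (forall x, pi (f x) = pi x) /\ S = range f.
have [||S [f [pif eS]] minS] := @len_min _ _ (@act F) P (range (idfun : {linear F -> F})).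
- by exists idfun.
- by move=> _ [f [_ ->]]; apply/actm_opsub/opsub_range.
have oS : opsub *:%R S by rewrite eS; apply: opsub_range.
have fS : f @` S = S.
  apply: minS; last exact: finS.
    exists (f \o f); split=> [x|]; first by rewrite /= !pif.
    rewrite eS; apply/seteqP; split=> [_ [_ [x _ <-] <-]|_ [x _ <-]]; first by exists x.
    by exists (f x) => //; exists x.
  by move=> _ [x _ <-]; rewrite eS; exists x.
have injf x : S x -> f x = 0 -> x = 0.
  move=> Sx fx0; have fB : forall x y, f (x - y) = f x - f y by move=> *; rewrite linearB.
  have oSa := actm_opsub oS; have oK := opsub_ker fB (@lin_act F F f) (@actm0 F).
  have e := len_map fB (@lin_act F F f) (@actm0 F) oSa (finS S).
  have : [set 0] = S `&` kerset f :> set F.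
    apply: (@len_eq_sub _ _ (@act F)).
    - by split=> [//|u v -> ->|r u ->] /=; rewrite ?subr0 ?actm0.
    - exact: opsubI.
    - by move=> u ->; split; [case: oS | apply: linear0].
    - exact: finS.
    rewrite len0; last exact: actm0.
    by move: e; rewrite fS -[LHS]add0n => /addIn.
  by move=> e0; have : (S `&` kerset f) x by []; rewrite -e0.
have [Q [s [injs sE]]] := sub_exists oS.
have [|r rE] := @fac_inj A _ _ _ s f injs.
  by move=> x; apply/sE; rewrite eS; exists x.
have injrs : injective (r \o s).
  move=> u v /= e; apply/eqP; rewrite -subr_eq0; apply/eqP; apply: injs; rewrite linear0.
  apply: injf; first by apply/sE; exists (u - v).
  by rewrite -rE linearB linearB e subrr linear0.
have [|t tE] := @fac_inj A _ _ _ (r \o s) (idfun : {linear Q -> Q}) injrs.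
  move=> q; have : S (s q) by apply/sE; exists q.
  rewrite -{1}fS => -[_ /sE[q' <-] e]; exists q'.
  by apply: injs; rewrite /= rE.
have surjp : forall u, exists q, (pi \o s) q = u.
  move=> u; have [x <-] := surjpi u.
  have /sE[q qE] : S (f x) by rewrite eS; exists x.
  by exists q; rewrite /= qE pif.
have [K [k ks]] := kernel_exists surjp.
exists n, K, Q, k, (pi \o s), s; split=> //.
- by apply: (@projective_retract _ _ _ r (s \o t)) (@projective_free A n).
- apply: (fin_gen_surj (p := r)) fF => q; exists (s (t q)); exact: tE q.
move=> x j; apply/asboolP => L mL; apply: contrapT => /negP yL.
set y : F := s (k x) in yL.
have py : pi y = 0 by exact: (ses_comp ks x).
have Sy : S y by apply/sE; exists (k x).
pose T : set F := [set z | S z /\ z 0 j \in L].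
have [lL _ _] := mL; have [L0 LB LA] := left_ideal_opsub lL.
have oT : opsub *:%R T.
  have [S0 SB SA] := oS; split=> [|u v [? ?] [? ?]|a u [? ?]]; split.
  - exact: S0.
  - by rewrite mxE.
  - exact: SB.
  - by rewrite !mxE; apply: LB.
  - exact: SA.
  - by rewrite mxE; apply: LA.
have [N [nu [_ nuE]]] := sub_exists oT.
have surjN u : exists z, (pi \o nu) z = u.
  have [q qE] := surjp u; have Sq : S (s q) by apply/sE; exists q.
  have [a aE] := maximal_left_ideal_coset (s q 0 j) mL yL.
  have /nuE[z zE] : T (s q - a *: y).
    split; last by rewrite !mxE.
    by have [_ SB SA] := oS; apply: SB => //; apply: SA.
  by exists z; rewrite /= zE linearB linearZZ py scaler0 subr0.
have [g gE] := @projective_free A n _ _ (pi \o nu) pi surjN.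
have eR : range (nu \o g) = S.
  apply: minS; last exact: finS.
    by exists (nu \o g); split.
  by move=> _ [z _ <-]; have [] : T (nu (g z)) by apply/nuE; exists (g z).
have : range (nu \o g) y by rewrite eR.
move=> [z _ zE]; have [_] : T (nu (g z)) by apply/nuE; exists (g z).
by rewrite -[nu (g z)]/((nu \o g) z) zE (negPf yL).
Qed.

End FiniteLength.

(** * Decomposition of the modules killed by a power of the radical *)

Section Iso.
Variable A : pzRingType.
Implicit Types U V W M N X : lmodType A.

Definition iso U V := exists (f : {linear U -> V}) (g : {linear V -> U}),
  (forall x, g (f x) = x) /\ (forall y, f (g y) = y).

Lemma iso_refl U : iso U U.
Proof. by exists idfun, idfun. Qed.

Lemma iso_sym U V : iso U V -> iso V U.
Proof. by move=> [f [g [fK gK]]]; exists g, f. Qed.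

Lemma iso_trans U V W : iso U V -> iso V W -> iso U W.
Proof.
move=> [f [g [fK gK]]] [f' [g' [fK' gK']]]; exists (f' \o f), (g \o g').
by split=> x /=; rewrite ?fK' ?gK.
Qed.

Lemma iso_prod U V U' V' : iso U U' -> iso V V' -> iso (U * V)%type (U' * V')%type.
Proof.
move=> [f [g [fK gK]]] [f' [g' [fK' gK']]]; exists (lprod f f'), (lprod g g').
by split=> -[x y]; rewrite /= /lpair_fun /= ?fK ?fK' ?gK ?gK'.
Qed.

Lemma bij_iso U V (f : {linear U -> V}) : injective f -> (forall y, exists x, f x = y) -> iso U V.
Proof.
move=> injf surjf; have [|g gE] := @fac_inj A _ _ _ f (idfun : {linear V -> V}) injf.
  by move=> y; apply: surjf.
by exists f, g; split=> // x; apply: injf; rewrite gE.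
Qed.

Lemma isomorphic_iso U V : isomorphic U V -> iso U V.
Proof.
by move=> [f [g fK gK]]; apply: (bij_iso (f := f)) (can_inj fK) _ => y; exists (g y).
Qed.

Lemma iso_fin_gen U V : iso U V -> fin_gen U -> fin_gen V.
Proof. by move=> [f [g [_ gK]]]; apply: (fin_gen_surj (p := f)) => y; exists (g y). Qed.

Lemma iso_triv X : zero_module X -> iso (triv_mod A) X.
Proof.
move=> X0; exists \0, \0; split=> x /=; last by rewrite [x]X0.
by rewrite [x]triv_mod0.
Qed.

Lemma iso_prod0 U : iso (U * triv_mod A)%type U.
Proof.
exists fst, (linl _ _); split=> // -[x y] /=; rewrite /lpair_fun /=.
by congr (_, _); rewrite [y]triv_mod0.
Qed.

Lemma iso_bp_cat (I : Type) (F : I -> lmodType A) l1 l2 :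
  iso (bp F (l1 ++ l2)) (bp F l1 * bp F l2)%type.
Proof.
elim: l1 => [|a l1 IH] /=.
  exists (linr _ _), snd; split=> // -[x y] /=; rewrite /lpair_fun /=.
  by congr (_, _); rewrite [x]triv_mod0.
apply: (iso_trans (iso_prod (iso_refl (F a)) IH)).
exists (lpair (lpair fst (fst \o snd)) (snd \o snd)), (lpair (fst \o fst) (lpair (snd \o fst) snd)).
by split; [case=> x [y z] | case=> -[x y] z].
Qed.

Lemma ses_iso U V W U' W' (i : {linear U -> V}) (p : {linear V -> W}) :
  ses i p -> iso U' U -> iso W' W -> exists (i' : {linear U' -> V}) (p' : {linear V -> W'}), ses i' p'.
Proof.
move=> s [f [g [fK gK]]] [f' [g' [fK' gK']]]; exists (i \o f), (g' \o p); split.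
- by move=> u /(ses_inj s) fu0; rewrite -[u]fK fu0 linear0.
- by move=> w; have [v vE] := ses_surj s (f' w); exists v; rewrite /= vE fK'.
- by move=> u /=; rewrite (ses_comp s) linear0.
- move=> v /= e; have [|u uE] := ses_exact s (v := v).
    by rewrite -[p v]gK' e linear0.
  by exists (g u); rewrite /= gK.
Qed.

Definition killed (I : ideal2 A) X := forall a (x : X), a \in ideal2_val I -> a *: x = 0.

Definition fin_decomp (I : ideal2 A) := exists s (F : 'I_s -> lmodType A),
  (forall a, fin_gen (F a)) /\
  forall X, fin_gen X -> killed I X -> exists l, iso (bp F l) X.

(** [X'] is [I X], described as the least submodule that contains all products;
    [X''] is the quotient by it. *)
Lemma ideal_submodule (I : ideal2 A) X :
  (forall a b (x : X), a \in ideal2_val I -> b \in ideal2_val I -> a *: (b *: x) = 0) ->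
  exists (X' X'' : lmodType A) (i : {linear X' -> X}) (p : {linear X -> X''}),
    [/\ ses i p, killed I X' & killed I X''].
Proof.
move=> kill2.
pose inS (T : set X) := forall a x, a \in ideal2_val I -> T (a *: x).
pose S : set X := [set x | forall T : set X, opsub *:%R T -> inS T -> T x].
have oS : opsub *:%R S.
  split=> [T [T0 _ _] _ //|x y Sx Sy T oT IT|a x Sx T oT IT].
    by have [_ TB _] := oT; apply: TB; [apply: Sx | apply: Sy].
  by have [_ _ TA] := oT; apply: TA; apply: Sx.
have [X' [X'' [i [p [s Si]]]]] := ses_sub oS.
exists X', X'', i, p; split=> // [a x aI|a w aI].
  apply: (ses_inj s); rewrite linearZZ.
  pose T : set X := [set y | forall b, b \in ideal2_val I -> b *: y = 0].
  have : S (i x) by apply/Si; exists x.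
  move=> /(_ T) h; apply: h aI.
    split=> [b bI|y z Ty Tz b bI|c y Ty b bI]; first by rewrite scaler0.
      by rewrite scalerBr Ty // Tz // subrr.
    by rewrite scalerA Ty //; have [] := ideal2_mul c bI.
  by move=> b y bI c cI; apply: kill2.
have [v <-] := ses_surj s w; rewrite -linearZZ.
have /Si[u <-] : S (a *: v) by move=> T _; apply.
exact: ses_comp s u.
Qed.

End Iso.

(** Modules over the quotient ring [A / I] and modules over [A] killed by [I] are
    the same; the two changes of scalars keep the carrier. *)
Section Scalars.
Variables (A : pzRingType) (I : ideal2 A).
Let C := quot_ring I.
Let pi (a : A) : C := (\pi_(quot_ring I) a)%qT.

Let piM a b : pi (a * b) = pi a * pi b.
Proof. exact: pi_quot_mul. Qed.

Let piD a b : pi (a + b) = pi a + pi b.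
Proof. exact: Quotient.pi_add. Qed.

Let pi1 : pi 1 = 1.
Proof. by rewrite /pi piE. Qed.

Let reprC (c : C) : pi (repr c) = c.
Proof. exact: reprK. Qed.

Let pi_eq a b : pi a = pi b <-> a - b \in ideal2_val I.
Proof.
rewrite (Quotient.idealrBE (ideal2_val I)).
by split=> [e|/eqP//]; apply/eqP.
Qed.

Let pi0 : pi 0 = 0.
Proof. by apply: (addrI (pi 0)); rewrite -piD !addr0. Qed.

Let pi_I a : a \in ideal2_val I -> pi a = 0.
Proof. by move=> aI; rewrite -pi0; apply/pi_eq; rewrite subr0. Qed.

Section Restrict.
Variable N : lmodType C.
Definition restrict : Type := N.
HB.instance Definition _ := GRing.Zmodule.on restrict.

Definition restrict_scale (a : A) (x : restrict) : restrict := pi a *: (x : N).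

Fact restrict_scaleA a b v : restrict_scale a (restrict_scale b v) = restrict_scale (a * b) v.
Proof. by rewrite /restrict_scale scalerA piM. Qed.
Fact restrict_scale1 : left_id 1 restrict_scale.
Proof. by move=> v; rewrite /restrict_scale pi1 scale1r. Qed.
Fact restrict_scaleDr : right_distributive restrict_scale +%R.
Proof. by move=> a u v; rewrite /restrict_scale scalerDr. Qed.
Fact restrict_scaleDl v : {morph restrict_scale^~ v : a b / a + b}.
Proof. by move=> a b; rewrite /restrict_scale piD scalerDl. Qed.

HB.instance Definition _ := GRing.Zmodule_isLmodule.Build A restrict
  restrict_scaleA restrict_scale1 restrict_scaleDr restrict_scaleDl.
End Restrict.

Section Corestrict.
Variable X : lmodType A.
Hypothesis kX : killed I X.

Definition corestrict of killed I X : Type := X.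
HB.instance Definition _ := GRing.Zmodule.on (corestrict kX).

Definition corestrict_scale (c : C) (x : corestrict kX) : corestrict kX := repr c *: (x : X).

Let scaleE a (x : X) : corestrict_scale (pi a) x = a *: x.
Proof.
apply/eqP; rewrite -subr_eq0 /corestrict_scale -scalerBl; apply/eqP/kX.
by apply/pi_eq; rewrite reprC.
Qed.

Fact corestrict_scaleA c d v :
  corestrict_scale c (corestrict_scale d v) = corestrict_scale (c * d) v.
Proof. by rewrite -[c]reprC -[d]reprC -piM !scaleE scalerA. Qed.
Fact corestrict_scale1 : left_id 1 corestrict_scale.
Proof. by move=> v; rewrite -pi1 scaleE scale1r. Qed.
Fact corestrict_scaleDr : right_distributive corestrict_scale +%R.
Proof. by move=> c u v; rewrite /corestrict_scale scalerDr. Qed.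
Fact corestrict_scaleDl v : {morph corestrict_scale^~ v : c d / c + d}.
Proof. by move=> c d; rewrite -[c]reprC -[d]reprC -piD !scaleE scalerDl. Qed.

HB.instance Definition _ := GRing.Zmodule_isLmodule.Build C (corestrict kX)
  corestrict_scaleA corestrict_scale1 corestrict_scaleDr corestrict_scaleDl.

Definition corestrict_mod : lmodType C := corestrict kX.

Lemma fin_gen_corestrict : fin_gen X -> fin_gen corestrict_mod.
Proof.
move=> [n [g gE]]; exists n, g => x; have [c cE] := gE x.
exists (fun i => pi (c i)); rewrite [LHS]cE; apply: eq_bigr => i _.
by rewrite -[RHS]/(corestrict_scale (pi (c i)) (g i)) scaleE.
Qed.

Lemma iso_corestrict (N : lmodType C) : iso corestrict_mod N -> iso X (restrict N : lmodType A).
Proof.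
move=> [f [g [fK gK]]].
have fL : linear (f : X -> restrict N).
  move=> a x y; rewrite -[RHS]/(pi a *: f x + f y) -linearP; congr (f _).
  by congr (_ + _); rewrite -[RHS]/(corestrict_scale (pi a) x) scaleE.
apply: (bij_iso (f := mklin fL)); first exact: can_inj fK.
by move=> y; exists (g y); apply: gK.
Qed.

End Corestrict.

Lemma killed_restrict (N : lmodType C) : killed I (restrict N).
Proof. by move=> a x aI; rewrite -[LHS]/(pi a *: (x : N)) pi_I // scale0r. Qed.

Lemma iso_restrict_prod (M N : lmodType C) :
  iso (restrict (M * N)%type : lmodType A) ((restrict M : lmodType A) * (restrict N : lmodType A))%type.
Proof.
have fL : linear (fun x : restrict (M * N)%type => (x.1 : restrict M, x.2 : restrict N)).
  by move=> a x y.
by apply: (bij_iso (f := mklin fL)) => [[x y] [x' y'] //|y]; exists y; case: y.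
Qed.

End Scalars.

Section Decompose.
Variables (A : pzRingType) (R : comPzRingType) (phi : {rmorphism R -> A}).
Hypothesis artR : artinian R.
Hypothesis genA : exists (n : nat) (g : 'I_n -> A),
  forall a, exists c : 'I_n -> R, a = \sum_(i < n) phi (c i) * g i.
Implicit Types U V W X Y : lmodType A.

Lemma mod_len_pos X : fin_gen X -> ~ zero_module X -> (0 < mod_len phi X)%N.
Proof.
move=> fX nX; rewrite lt0n; apply/eqP => e; apply: nX => x.
have : [set 0] = [set: X].
  apply: (@len_eq_sub _ _ (@actm A R phi X)) => //.
  - by split=> [//|u v -> ->|r u ->] /=; rewrite ?subr0 ?actm0.
  - exact: fin_actm.
  by rewrite len0 //; exact: actm0.
by move=> e0; have : [set: X] x by []; rewrite -e0.
Qed.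

(** Split off summands by induction on the length.  Members of the given family
    that are not finitely generated are replaced by the zero module; the finitely
    generated indecomposables are isomorphic to none of them. *)
Lemma finite_rep_decomp (I : ideal2 A) : finite_rep_type (quot_ring I) -> fin_decomp I.
Proof.
move=> [s [F0 F0P]].
have Fex a : exists X : lmodType A, fin_gen X /\
    (fin_gen (restrict (F0 a) : lmodType A) -> X = restrict (F0 a)).
  have [fFa|nfFa] := pselect (fin_gen (restrict (F0 a) : lmodType A)).
    by exists (restrict (F0 a)).
  by exists (triv_mod A); split=> //; apply: fin_gen_free.
have [F FP] := choice Fex.
exists s, F; split=> [a|]; first by case: (FP a).
move=> X; have [d] := ubnP (mod_len phi X); elim: d X => // d IH X leX fX kX.
have [X0|nX] := pselect (zero_module X); first by exists [::]; apply: iso_triv.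
have [indX|nind] := pselect (indecomposable (corestrict_mod kX)).
  have [a /isomorphic_iso/iso_corestrict isoa] := F0P _ (fin_gen_corestrict kX fX) indX.
  exists [:: a]; apply: (iso_trans (iso_prod0 _)); apply: iso_sym.
  by have [_ ->] := FP a; last exact: iso_fin_gen isoa fX.
have [M1 [M2 [/isomorphic_iso/iso_corestrict iso12 [nM1 nM2]]]] : exists M1 M2 : lmodType (quot_ring I),
    isomorphic (corestrict_mod kX) (M1 * M2)%type /\ ~ zero_module M1 /\ ~ zero_module M2.
  apply: contrapT => nex; apply: nind; split=> // M1 M2 isoM.
  have [?|n1] := pselect (zero_module M1); first by left.
  right; apply: contrapT => n2; apply: nex; exists M1, M2; split=> //.
have iso' := iso_trans iso12 (iso_restrict_prod M1 M2).
set N1 : lmodType A := restrict M1 in iso'; set N2 : lmodType A := restrict M2 in iso'.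
have fN : fin_gen (N1 * N2)%type := iso_fin_gen iso' fX.
have f1 : fin_gen N1.
  by apply: (fin_gen_surj (p := (fst : {linear (N1 * N2)%type -> N1}))) fN => x; exists (x, 0).
have f2 : fin_gen N2.
  by apply: (fin_gen_surj (p := (snd : {linear (N1 * N2)%type -> N2}))) fN => x; exists (0, x).
have [i [p s12]] : exists (i : {linear N1 -> X}) (p : {linear X -> N2}), ses i p.
  have [f [g [fK gK]]] := iso'.
  exists (g \o linl _ _), ((snd : {linear (N1 * N2)%type -> N2}) \o f); split=> /=.
  - by move=> u /(congr1 f); rewrite gK linear0 => -[].
  - by move=> w; exists (g (0, w)); rewrite /= gK.
  - by move=> u; rewrite gK.
  - move=> v e; exists (f v).1; rewrite -[RHS]fK; congr (g _).
    by rewrite [RHS]surjective_pairing e.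
have eX := mod_len_ses artR genA s12 fX f1.
have p1 := mod_len_pos f1 nM1; have p2 := mod_len_pos f2 nM2.
have [||l1 iso1] := IH N1 _ f1; [by lia | exact: killed_restrict |].
have [||l2 iso2] := IH N2 _ f2; [by lia | exact: killed_restrict |].
exists (l1 ++ l2); apply: (iso_trans (iso_bp_cat _ _ _)).
by apply: (iso_trans (iso_prod iso1 iso2)); apply: iso_sym.
Qed.

(** A finite intersection of maximal left ideals of least length cannot be
    shrunk by a further maximal left ideal. *)
Lemma jacobson_finite : exists s (L : 'I_s -> {pred A}),
  (forall i, maximal_left_ideal (L i)) /\ forall x, (forall i, x \in L i) -> x \in jacobson A.
Proof.
pose P (S : set A^o) := exists s (L : 'I_s -> {pred A}),
  (forall i, maximal_left_ideal (L i)) /\ S = [set x | forall i, x \in L i].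
have fA := fin_actm artR genA (@fin_gen_reg A).
have opP S : P S -> opsub (@actm A R phi A^o) S.
  move=> [s [L [mL ->]]]; split=> [i|x y Sx Sy i|r x Sx i]; have [lL _ _] := mL i.
  - by have [] := left_ideal_zmod lL.
  - by have [_] := left_ideal_zmod lL; apply.
  - exact: left_idealM.
have P0 : P setT.
  exists 0%N, (fun _ => (predT : {pred A})); split; first by case.
  by apply/seteqP; split=> // x _ [].
have [S [s [L [mL eS]]] minS] := len_min P0 opP.
exists s, L; split=> // x xL; apply/asboolP => K mK.
pose L' (i : 'I_s.+1) : {pred A} := if unlift ord0 i is Some j then L j else K.
have eS' : S `&` [set x | x \in K] = S.
  apply: minS.
  - exists s.+1, L'; split=> [i|]; first by rewrite /L'; case: (unlift ord0 i).
    rewrite eS; apply/seteqP; split=> [y [yL yK] i|y yL'].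
      by rewrite /L'; case: (unlift ord0 i).
    split=> [i|]; first by have := yL' (lift ord0 i); rewrite /L' liftK.
    by have := yL' ord0; rewrite /L' unlift_none.
  - by move=> y [].
  - by apply: fin_sub fA.
have : (S `&` [set x | x \in K]) x by rewrite eS' eS.
by case.
Qed.

Definition simple_module X := forall S : set X, opsub *:%R S -> S = [set 0] \/ S = setT.

Section Semisimple.
Variables (s : nat) (F : 'I_s -> lmodType A).
Hypothesis simF : forall a, simple_module (F a).

(** Exchange: adding the image of a simple module to a submodule either changes
    nothing or adds a direct summand. *)
Lemma exchange X (l : seq 'I_s) (f : {linear bp F l -> X}) a (h : {linear F a -> X}) :
  injective f -> exists (l' : seq 'I_s) (f' : {linear bp F l' -> X}),
  injective f' /\ (forall y z, exists y', f' y' = f y + h z).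
Proof.
move=> injf; pose S : set (F a) := h @^-1` range f.
have oS : opsub *:%R S.
  have [S0 SB SA] := opsub_range f.
  split=> [|x y|c x]; rewrite /S /preimage /=.
  - by rewrite linear0.
  - by rewrite linearB; apply: SB.
  - by rewrite linearZZ; apply: SA.
have [S0|ST] := simF oS; last first.
  exists l, f; split=> // y z; have [y' _ <-] : S z by rewrite ST.
  by exists (y + y'); rewrite linearD.
exists (a :: l), (lcopair h f); split=> [[z y] [z' y'] /=|y z]; last first.
  by exists (z, y); rewrite /= /lcopair_fun /= addrC.
rewrite /lcopair_fun /= => e.
have hz : h (z - z') = f (y' - y).
  by rewrite !linearB; apply/eqP; rewrite subr_eq addrAC -subr_eq opprK e addrC.
have : S (z - z') by exists (y' - y).
rewrite S0 => /= /eqP; rewrite subr_eq0 => /eqP ezz; rewrite ezz in e *.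
by congr (_, _); apply: injf; apply: addrI e.
Qed.

Lemma exchange_bp X (l : seq 'I_s) (f : {linear bp F l -> X}) k (h : {linear bp F k -> X}) :
  injective f -> exists (l' : seq 'I_s) (f' : {linear bp F l' -> X}),
  injective f' /\ (forall y z, exists y', f' y' = f y + h z).
Proof.
elim: k l f h => [|a k IH] l f h injf.
  exists l, f; split=> // y z; exists y.
  by rewrite [z]triv_mod0 linear0 addr0.
have [l1 [f1 [inj1 im1]]] := exchange (h \o linl _ _) injf.
have [l2 [f2 [inj2 im2]]] := IH l1 f1 (h \o linr _ _) inj1.
exists l2, f2; split=> // y [z z'].
have [y1 y1E] := im1 y z; have [y2 y2E] := im2 y1 z'.
exists y2; rewrite y2E y1E /= -addrA -linearD.
by congr (_ + h _); congr (_, _) => /=; rewrite ?addr0 ?add0r.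
Qed.

(** If [A] modulo the annihilator is a sum of simple modules, then the cyclic
    submodules of [X] are images of that sum, and can be adjoined one by
    one. *)
Lemma semisimple X (l : seq 'I_s) (q : {linear A^o -> bp F l}) :
  (forall y, exists a, q a = y) ->
  (forall (a : A) (x : X), q a = 0 -> a *: x = 0) -> fin_gen X -> exists l', iso (bp F l') X.
Proof.
move=> surjq kq [n [g gE]].
suff [l' [f [injf imf]]] : exists (l' : seq 'I_s) (f : {linear bp F l' -> X}), injective f /\
    forall c : 'I_n -> A, exists y, f y = \sum_(i < n) c i *: g i.
  by exists l'; apply: (bij_iso injf) => x; have [c ->] := gE x.
elim: n g {gE} => [|n IH] g.
  exists [::], \0; split=> [x y _|c]; first by rewrite [x]triv_mod0 [y]triv_mod0.
  by exists 0; rewrite big_ord0.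
have [l1 [f1 [inj1 im1]]] := IH (fun i => g (lift ord0 i)).
have [|h hE] := @fac_surj A _ _ _ q (orbit_map (g ord0)) surjq.
  by move=> a qa; apply: kq.
have [l2 [f2 [inj2 im2]]] := exchange_bp h inj1.
exists l2, f2; split=> // c; have [y1 y1E] := im1 (fun i => c (lift ord0 i)).
have [y yE] := im2 y1 (q (c ord0)).
by exists y; rewrite yE y1E hE big_ord_recl addrC.
Qed.

End Semisimple.

Lemma simple_quotient (L : {pred A}) : maximal_left_ideal L ->
  exists (F : lmodType A) (p : {linear A^o -> F}),
  [/\ forall y, exists a, p a = y, forall a, p a = 0 <-> a \in L & simple_module F].
Proof.
move=> mL; have [lL _ _] := mL.
have [F [p [surjp pE]]] := quo_exists (left_ideal_opsub lL).
exists F, p; split=> // [a|S oS]; first by split=> [/pE//|aL]; apply/pE.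
have [[y Sy ny]|nex] := pselect (exists2 y, S y & y <> 0); last first.
  left; apply/seteqP; split=> [y Sy|_ ->]; last by case: oS.
  by apply: contrapT => ny; apply: nex; exists y.
right; apply/seteqP; split=> // z _.
have [b bE] := surjp y; have [c cE] := surjp z.
have bL : b \notin L by apply/negP => bL; apply: ny; rewrite -bE; apply/pE.
have [a aE] := maximal_left_ideal_coset c mL bL.
have -> : z = (a : A) *: y.
  apply/eqP; rewrite -subr_eq0 -cE -bE -linearZZ -linearB; apply/eqP/pE; exact: aE.
by have [_ _ SA] := oS; apply: SA.
Qed.

Lemma jacobson_decomp : fin_decomp (ideal2X (jacobson A) 1).
Proof.
have [s [L [mL LJ]]] := jacobson_finite.
have [F FP] := choice (fun i => simple_quotient (mL i)).
pose p i := projT1 (cid (FP i)); have pP i := projT2 (cid (FP i)).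
rewrite -/(p _) in pP.
have simF a : simple_module (F a) by have [] := pP a.
exists s, F; split=> [a|X fX kX].
  by have [surjp _ _] := pP a; apply: fin_gen_surj surjp (@fin_gen_reg A).
(* The Chinese remainder theorem, one maximal left ideal at a time. *)
have crt (k : seq 'I_s) : exists (l : seq 'I_s) (q : {linear A^o -> bp F l}),
    (forall y, exists a, q a = y) /\ forall a, q a = 0 <-> forall i, i \in k -> a \in L i.
  elim: k => [|i k [l [q [surjq qE]]]].
    exists [::], \0; split=> [y|a]; first by exists 0; rewrite [y]triv_mod0.
    by split.
  have [surjp pE _] := pP i.
  have qiE a : (forall j, j \in i :: k -> a \in L j) <-> p i a = 0 /\ q a = 0.
    split=> [h|[/pE aL /qE ak] j].
      split; first by apply/pE/h; rewrite inE eqxx.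
      by apply/qE => j jk; apply: h; rewrite inE jk orbT.
    by rewrite inE => /predU1P[->|/ak].
  have [sub|nsub] := pselect (forall a, q a = 0 -> a \in L i).
    exists l, q; split=> // a; rewrite qiE; split=> [qa|[]//].
    by split=> //; apply/pE/sub.
  have [t qt tL] : exists2 t, q t = 0 & t \notin L i.
    apply: contrapT => nex; apply: nsub => a qa; apply/negPn/negP => aL.
    by apply: nex; exists a.
  exists (i :: l), (lpair (p i) q); split=> [[u v]|a]; last first.
    by rewrite qiE /= /lpair_fun; split=> [[]//|[-> ->]].
  have [a aE] := surjq v; have [b bE] := surjp u.
  have [c cE] := maximal_left_ideal_coset (b - a) (mL i) tL.
  exists (a + c *: (t : A^o)); rewrite /= /lpair_fun; congr (_, _); last first.
    by rewrite linearD linearZZ qt scaler0 addr0.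
  apply/eqP; rewrite -subr_eq0 -oppr_eq0 opprB -bE -linearB; apply/eqP/pE.
  by move: cE; rewrite opprD addrA.
have [l [q [surjq qE]]] := crt (enum 'I_s).
apply: (semisimple simF surjq) fX => a x /qE aL; apply: kX.
have aJ : a \in jacobson A by apply: LJ => i; apply: aL; rewrite mem_enum.
apply/asboolP; exists 1%N, (fun _ => 1), (fun _ => a); split=> //.
by rewrite big_ord1 mul1r.
Qed.

End Decompose.

(** * The conjecture *)

Lemma ideal2X_mul (A : pzRingType) (I : ideal2 A) m n x y :
  x \in ideal2X I m -> y \in ideal2X I n -> x * y \in ideal2X I (m + n).
Proof.
move=> xI; elim: n y => [|n IH] y.
  by rewrite addn0 => _; have [] := ideal2_mul y xI.
rewrite addnS => /asboolP[k [a [b [aI bI ->]]]]; apply/asboolP.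
exists k, (fun i => x * a i), b; split=> // [i|]; first exact: IH.
by rewrite mulr_sumr; apply: eq_bigr => i _; rewrite mulrA.
Qed.

(** Entries of vectors in the kernel of a minimal cover lie in [J], so products
    of two elements of [J^m] kill it as soon as [J^(2m+1) = 0]. *)
Lemma auslander_reiten_of_decomp (A : pzRingType) m : artin_algebra A ->
  ideal2_eq0 (ideal2X (jacobson A) (2 * m + 1)) -> fin_decomp (ideal2X (jacobson A) m) ->
  auslander_reiten A.
Proof.
move=> [R [phi [artR phiC genA]]] J0 [s [F [fF decF]]] M fM extM.
apply: contrapT => nproj.
set I := ideal2X (jacobson A) m in decF.
pose kill2 (K : lmodType A) := forall a b (x : K),
  a \in ideal2_val I -> b \in ideal2_val I -> a *: (b *: x) = 0.
have covers (U : lmodType A) : fin_gen U -> exists c : proj_cover kill2 U, True.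
  move=> fU; have [n [K [Q [k [p [e [kp pQ fQ inje eJ]]]]]]] := minimal_cover artR genA fU.
  have fK := fin_gen_sub artR genA (ses_injective kp) fQ.
  have kK : kill2 K.
    move=> a b x aI bI; apply: (ses_inj kp); apply: inje; rewrite linear0.
    apply/rowP => j; rewrite scalerA !linearZZ !mxE; apply: J0.
    have abI : a * b \in ideal2X (jacobson A) (2 * m) by rewrite mul2n -addnn; apply: ideal2X_mul.
    rewrite addn1; apply/asboolP; exists 1%N, (fun _ => a * b), (fun _ => e (k x) 0 j).
    by split=> [_|_|]; [exact: abI | exact: eJ | rewrite big_ord1].
  by unshelve eexists; first exact: (ProjCover kp pQ fQ fK kK).
have [r [rM fr kr]] := fgres_exists covers fM; subst M.
have covers0 (U : lmodType A) : fin_gen U -> exists c : proj_cover (fun _ => True) U, True.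
  move=> fU; have [c _] := covers U fU.
  by exists (ProjCover (cover_ses c) (@cover_proj _ _ _ c) (cover_fg c) (cker_fg c) (C := fun _ => True) Logic.I).
have [rF rFP] := choice (fun a => fgres_exists covers0 (fF a)).
have eF : F = fun a => sy (rF a) 0 by apply/funext => a; have [->] := rFP a.
have fyF Y : fin_gen Y -> fin_len (@actm A R phi Y) setT := @fin_actm A R phi artR genA Y.
have extN n (h : {linear sy r n.+1 -> (sy r 0 * A^o)%type}) : ext_to (inc r n) h.
  have [r1 [r1M ext1]] := Ext_eq0_res (extM n.+1 (ltn0Sn n)).
  have [f [g [fK gK]]] := eq_iso r1M.
  exact: (ext_transfer fK gK ext1).
apply: (@no_family A R phi phiC fyF r fr _ _ _ s rF) => [n h|n h||a|k] //.
- have [g gE] := extN n (linl (sy r 0) A^o \o h).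
  by exists (fst \o g) => u /=; rewrite gE.
- have [g gE] := extN n (linr (sy r 0) A^o \o h).
  by exists (snd \o g) => u /=; rewrite gE.
- by have [] := rFP a.
have [X' [X'' [i [p [ip k' k'']]]]] := ideal_submodule (kr k).
have fX : fin_gen (sy r k.+1) by apply: fgres_sy.
have fX' := fin_gen_sub artR genA (ses_injective ip) fX.
have fX'' := fin_gen_surj (ses_surj ip) fX.
have [l' iso'] := decF X' fX' k'; have [l'' iso''] := decF X'' fX'' k''.
exists l', l''; rewrite eF in iso' iso''; exact: ses_iso ip iso' iso''.
Qed.

Theorem mainTheorem3 (A : pzRingType) (hA : artin_algebra A) :
  ((exists m : nat,
      [/\ (1 <= m)%N,
          ideal2_eq0 (ideal2X (jacobson A) (2 * m + 1)) &
          finite_rep_type (quot_ring (ideal2X (jacobson A) m))]) ->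
     auslander_reiten A)
  /\ (ideal2_eq0 (ideal2X (jacobson A) 3) -> auslander_reiten A).
Proof.
have [R [phi [artR _ genA]]] := hA.
split=> [[m [_ J0 frt]]|J0].
  apply: (auslander_reiten_of_decomp hA J0); exact: finite_rep_decomp artR genA _ frt.
apply: (auslander_reiten_of_decomp (m := 1) hA J0); exact: jacobson_decomp artR genA.
Qed.
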